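(* Let $0<\alpha<1$, $C>0$ and let $r\in\mathbb{N}$ be a positive integer. Let $\mathbf{PD}_\alpha^{(r)}$ be the law of the ranked jumps up to time $1$, with the $r$ largest removed, of a driftless $\alpha$-stable subordinator with Lévy density $\rho_\alpha(x)=C\alpha x^{-\alpha-1}$, $x>0$, divided by the sum of the jumps that remain. Then $\mathbf{PD}_\alpha^{(r)}$ is the same law as $\mathbf{PK}^{(r)}(\rho_\alpha^* )$, where $\rho_\alpha^*(x):=\alpha x^{-\alpha-1}\mathbf{1}_{\{0<x<1\}}$.
   Context: Trimmed stable law: let $\Delta_1>\Delta_2>\cdots$ be the ranked jumps on $[0,1]$ of the subordinator $(S_t)$ (points of a Poisson point process on $(0,\infty)$ with intensity $\rho_\alpha(x)dx$), $S_1=\sum_i\Delta_i$ and ${}^{(r)}S_1=S_1-\sum_{i=1}^r\Delta_i$. Then $\mathbf{PD}_\alpha^{(r)}$ is the law of $(\Delta_{r+1}/{}^{(r)}S_1,\Delta_{r+2}/{}^{(r)}S_1,\ldots)$. Negative binomial Poisson-Kingman law: for $r>0$ and a density $\rho$ on $(0,\infty)$ such that $\Pi(dx)=\rho(x)dx$ satisfies $\Pi\{(0,\infty)\}=\infty$, $\Pi\{(x,\infty)\}<\infty$ for $x>0$ and $\int_0^1x\,\Pi(dx)<\infty$, a negative binomial point process $\mathbb{B}^{(r)}\sim\mathcal{BN}(r,\rho)$ is a point process on $(0,\infty)$ with Laplace functional $\mathbb{E}(e^{-\mathbb{B}^{(r)}(f)})=\big(1+\int_0^\infty(1-e^{-f(x)})\Pi(dx)\big)^{-r}$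 for all nonnegative measurable $f$; equivalently, a Poisson point process with randomised intensity measure $\Gamma_r\Pi$, $\Gamma_r$ an independent Gamma$(r,1)$ variable. With its ordered points $J_{(1)}\ge J_{(2)}\ge\cdots$ and $T(\mathbb{B}^{(r)})=\sum_iJ_{(i)}$, $\mathbf{PK}^{(r)}(\rho)$ is the law of $\big(J_{(1)}/T(\mathbb{B}^{(r)}),J_{(2)}/T(\mathbb{B}^{(r)}),\ldots\big)$. *)

(* Defs.v *)
From HB Require Import structures.
From mathcomp Require Import all_boot all_order all_algebra.
From mathcomp Require Import all_classical all_reals all_analysis.
From mathcomp Require Import measurable_realfun.

Set Implicit Arguments.
Unset Strict Implicit.
Unset Printing Implicit Defensive.

Import Order.TTheory GRing.Theory Num.Theory.
Import numFieldNormedType.Exports.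

Local Open Scope classical_set_scope.
Local Open Scope ring_scope.
Local Open Scope ereal_scope.

Section independence.
Context {R : realType} {d d' : measure_display}.
Context {Omega : measurableType d} {T : measurableType d'}.
Variable P : probability Omega R.

(* Since the sets [B i] may be the whole space, the product rule for the full
   family contains the product rule for all its subfamilies. *)
Definition mutually_independent (n : nat) (X : 'I_n -> Omega -> T) : Prop :=
  forall B : 'I_n -> set T, (forall i, measurable (B i)) ->
    P (\bigcap_(i in [set: 'I_n]) (X i @^-1` B i)) =
    \big[mule/1]_(i < n) P (X i @^-1` B i).

End independence.

Section point_processes.
Context {R : realType} {d d' : measure_display}.
Context {Omega : measurableType d} {T : measurableType d'}.
Variable P : probability Omega R.

(* [X] has the Poisson distribution of parameter [l], with the convention that
   [X = +oo] almost surely when [l = +oo].  The second argument of the library's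
   [poisson_prob] is a dummy. *)
Definition poisson_distributed (X : Omega -> \bar R) (l : \bar R) : Prop :=
  match l with
  | lam%:E => forall k : nat,
      P [set w | X w = k%:R%:E] = poisson_prob lam 0 [set k]
  | +oo => P [set w | X w = +oo] = 1
  | -oo => False
  end.

(* [N w A] is the number of points of the configuration [w] that lie in [A]. *)
Definition poisson_point_process (N : Omega -> set T -> \bar R)
    (intensity : set T -> \bar R) : Prop :=
  [/\ forall A, measurable A -> measurable_fun setT (fun w => N w A),
      forall A, measurable A ->
        poisson_distributed (fun w => N w A) (intensity A)
    & forall (n : nat) (A : 'I_n -> set T),
        (forall i, measurable (A i)) -> trivIset setT A ->
        mutually_independent P (fun (i : 'I_n) w => N w (A i))].

End point_processes.

Section ranked_points.
Context {R : realType}.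

(* [ranked_point N i] is the (i+1)-st largest point, counted with multiplicity,
   of the configuration on (0, oo) with counting measure [N]; it is 0 when
   there are at most [i] points. *)
Definition ranked_point (N : set R -> \bar R) (i : nat) : R :=
  sup [set x : R | (0 < x)%R /\ i.+1%:R%:E <= N `[x, +oo[%classic].

End ranked_points.

Section subordinators.
Context {R : realType} {d : measure_display} {Omega : measurableType d}.
Variable P : probability Omega R.

(* A real-valued process indexed by time; only times [t >= 0] matter. *)
Implicit Type S : R -> Omega -> R.

Definition subordinator S : Prop :=
  [/\ (forall t : R, (0 <= t)%R -> measurable_fun setT (S t)),
      (forall w, S 0%R w = 0%R),
      (forall w (s t : R), (0 <= s)%R -> (s <= t)%R -> (S s w <= S t w)%R) /\
      (forall w (t : R), (0 <= t)%R -> S s w @[s --> t^'+] --> S t w),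
      (forall (n : nat) (t : nat -> R), (0 <= t 0%N)%R ->
        (forall i, (t i <= t i.+1)%R) ->
        mutually_independent P
          (fun (i : 'I_n) w => (S (t i.+1) w - S (t i) w)%R))
    & (forall s t : R, (0 <= s)%R -> (s <= t)%R ->
        forall B : set R, measurable B ->
        P ((fun w => (S t w - S s w)%R) @^-1` B) = P (S (t - s)%R @^-1` B))].

Definition jump S (w : Omega) (t : R) : R :=
  (S t w - lim (S s w @[s --> t^'-]))%R.

(* The number of times t > 0 such that the jump of S at t is positive and
   (t, jump at t) lies in A. *)
Definition jump_measure S (w : Omega) (A : set (R * R)) : \bar R :=
  counting [set t : R | [/\ (0 < t)%R, (0 < jump S w t)%R & A (t, jump S w t)]].

(* The measure dt rho(x)dx on (0, oo) x (0, oo). *)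
Definition time_size_intensity (rho : R -> R) (A : set (R * R)) : \bar R :=
  \int[(@lebesgue_measure R) \x (@lebesgue_measure R)]_(z in
      A `&` (`]0%R, +oo[%classic `*` `]0%R, +oo[%classic)) (rho z.2)%:E.

(* The Levy density [rho] is attached to [S] through the Levy-Ito description
   of its jumps, and the absence of drift says that [S] is the sum of them. *)
Definition driftless_subordinator S (rho : R -> R) : Prop :=
  [/\ subordinator S,
      poisson_point_process P (jump_measure S) (time_size_intensity rho)
    & forall w (t : R), (0 <= t)%R ->
        (S t w)%:E =
        \esum_(s in [set s : R | (0 < s)%R /\ (s <= t)%R]) (jump S w s)%:E].

(* The jumps up to time 1, as a point configuration on (0, oo). *)
Definition jumps_to_1 S (w : Omega) (B : set R) : \bar R :=
  jump_measure S w (`[0%R, 1%R]%classic `*` B).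

Definition trimmed_sum S (r : nat) (w : Omega) : R :=
  (S 1%R w - \sum_(i < r) ranked_point (jumps_to_1 S w) i)%R.

Definition trimmed_ratios S (r : nat) (w : Omega) : nat -> R :=
  fun j => (ranked_point (jumps_to_1 S w) (r + j) / trimmed_sum S r w)%R.

End subordinators.

Section negative_binomial.
Context {R : realType} {d : measure_display} {Omega : measurableType d}.
Variable P : probability Omega R.

(* A point process on (0, oo), viewed as a random measure on the real line:
   integer-valued, carried by (0, oo) and finite on its compact subsets. *)
Definition point_process_pos (N : Omega -> {measure set R -> \bar R}) : Prop :=
  [/\ forall A, measurable A -> measurable_fun setT (fun w => N w A),
      forall w A, measurable A ->
        N w A = +oo \/ exists k : nat, N w A = k%:R%:E,
      forall w, N w `]-oo, 0%R]%classic = 0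
    & forall w (a b : R), (0 < a)%R -> N w `[a, b]%classic < +oo].

(* BN(r, rho), through its Laplace functional.  Both [expeR (- +oo)] and
   [+oo^-1] are 0. *)
Definition negative_binomial_process (r : R) (rho : R -> R)
    (N : Omega -> {measure set R -> \bar R}) : Prop :=
  point_process_pos N /\
  forall f : R -> R, measurable_fun (`]0%R, +oo[%classic : set R) f ->
    (forall x : R, (0 < x)%R -> (0 <= f x)%R) ->
    \int[P]_w expeR (- \int[N w]_(x in `]0%R, +oo[%classic) (f x)%:E) =
    ((1 + \int[@lebesgue_measure R]_(x in `]0%R, +oo[%classic)
            ((1 - expR (- f x)) * rho x)%R%:E) `^ r)^-1.

(* The sum of all points, as an extended real; it is almost surely finite
   under the integrability assumption on the density. *)
Definition total_mass (N : {measure set R -> \bar R}) : \bar R :=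
  \sum_(0 <= i <oo) (ranked_point N i)%:E.

Definition normalized_points (N : Omega -> {measure set R -> \bar R})
    (w : Omega) : nat -> R :=
  fun j => (ranked_point (N w) j / fine (total_mass (N w)))%R.

End negative_binomial.

Section sequence_laws.
Context {R : realType} {d : measure_display} {Omega : measurableType d}.

(* The product sigma-algebra on sequences, generated by the coordinates. *)
Definition seq_measurable : set (set (nat -> R)) :=
  <<s \bigcup_(i in [set: nat])
        preimage_set_system setT (fun u : nat -> R => u i) measurable >>.

Definition law (P : probability Omega R) (X : Omega -> nat -> R)
  (A : set (nat -> R)) : \bar R := P (X @^-1` A).

End sequence_laws.

Section laws.
Context {R : realType}.

Definition stable_density (alpha C : R) (x : R) : R :=
  (C * alpha * x `^ (- alpha - 1))%R.

Definition truncated_stable_density (alpha : R) (x : R) : R :=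
  (alpha * x `^ (- alpha - 1) * \1_(`]0%R, 1%R[%classic : set R) x)%R.

(* PD_alpha^(r), computed from a realisation [S] of the subordinator. *)
Definition PD {d : measure_display} {Omega : measurableType d}
    (P : probability Omega R) (S : R -> Omega -> R) (r : nat) :=
  law P (trimmed_ratios S r).

(* PK^(r)(rho), computed from a realisation [N] of BN(r, rho). *)
Definition PK {d : measure_display} {Omega : measurableType d}
    (P : probability Omega R) (N : Omega -> {measure set R -> \bar R}) :=
  law P (normalized_points N).

End laws.

(* Main.v *)
Require Import Defs.
From HB Require Import structures.
From mathcomp Require Import finmap.
From mathcomp Require Import all_boot all_order all_algebra.
From mathcomp Require Import all_classical all_reals all_analysis.
From mathcomp Require Import measurable_realfun.
From mathcomp Require Import ring lra zify.

Set Implicit Arguments.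
Unset Strict Implicit.
Unset Printing Implicit Defensive.

Import Order.TTheory GRing.Theory Num.Theory.
Import numFieldNormedType.Exports.

Local Open Scope classical_set_scope.
Local Open Scope ring_scope.

(* In the time scale [t = C x^-alpha] the jumps up to time 1 form a unit-rate
   Poisson process [K], whose r-th point [Gamma] is Gamma(r, 1) distributed and
   corresponds to the r-th largest jump.  By the strong Markov property, given
   [Gamma] the jumps relative to the r-th one form a Poisson process on (0, 1)
   with intensity [Gamma] times the truncated density, that is, BN(r) after
   integrating [Gamma] out.  Dividing all jumps by the r-th one does not affect
   the normalised sequence.  The two ranked sequences are compared through the
   joint generating functions of the numbers of points in disjoint windows,
   both equal to
   [(1 + sum_i (1 - z_i) (x_{i+1}^-alpha - x_i^-alpha))^-r]. *)

(** * Laws of integer-valued vectors *)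

Section power_series.
Local Open Scope ereal_scope.
Context {R : realType}.
Implicit Types (a b : nat -> R) (z : R).

(** The two processes are arbitrary realisations on unrelated probability spaces, so the laws are
    compared without a coupling. They meet in one formula: the generating function of the window
    counts is E exp(-lam Gamma) on one side, and on the other the defining Laplace functional at a
    step function with values -ln z_i. This forces 0 < z_i <= 1, so uniqueness is drawn from z near
    0 and not at 0.

    The constant C disappears because the tail C x^-alpha is a power: a jump is at least x times the
    r-th one exactly when its time in the new scale is at most x^-alpha Gamma.

    The obstacle is that independence of increments is given at deterministic times only. The strong
    Markov property is reached by rounding Gamma up to a grid, each value of the rounded time being
    decided by the past, and then by right continuity of the paths. A tie at rank r must also be
    excluded: the increments of K after Gamma count all the jumps ranked after the r-th only if
    K(Gamma) = r, which holds almost surely. *)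

Lemma power_series_tail_le a z m : (forall k, 0 <= a k)%R ->
  \sum_(0 <= k <oo) (a k)%:E <= 1 -> (0 <= z)%R -> (z <= 1)%R ->
  \sum_(m <= k <oo) (z ^+ k * a k)%:E <= (z ^+ m)%:E.
Proof.
move=> a0 a1 z0 z1.
apply: (@le_trans _ _ (\sum_(m <= k <oo) ((z ^+ m)%:E * (a k)%:E))).
  rewrite eseries_cond [leRHS]eseries_cond; apply: lee_nneseries => k.
    by move=> _ _; rewrite lee_fin mulr_ge0// exprn_ge0.
  move=> /andP[_ mk]; rewrite -EFinM lee_fin ler_wpM2r//.
  by rewrite ler_wiXn2l.
rewrite nneseriesZl; last by move=> k _; rewrite lee_fin.
rewrite -[leRHS]mule1 lee_wpmul2l ?lee_fin ?exprn_ge0//.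
apply: le_trans a1; rewrite (@nneseries_split _ _ 0 m); last first.
  by move=> k _; rewrite lee_fin.
by rewrite add0n leeDr// sume_ge0// => k _; rewrite lee_fin.
Qed.

(** Once the lower coefficients agree, dividing by [z ^+ m] leaves [a m - b m] equal to a difference
    of tails of size at most z, and z can be taken arbitrarily small. *)
Lemma power_series_unique a b :
  (forall k, 0 <= a k)%R -> \sum_(0 <= k <oo) (a k)%:E <= 1 ->
  (forall k, 0 <= b k)%R -> \sum_(0 <= k <oo) (b k)%:E <= 1 ->
  (forall z, 0 < z -> z <= 1 -> \sum_(0 <= k <oo) (z ^+ k * a k)%:E =
                        \sum_(0 <= k <oo) (z ^+ k * b k)%:E)%R ->
  forall k, a k = b k.
Proof.
move=> a0 a1 b0 b1 ab k; have [m] := ubnP k; elim: m => // m IH in k *.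
rewrite ltnS leq_eqVlt => /predU1P[{k}->|km]; last exact: IH.
have split c z : (forall k, 0 <= c k)%R -> \sum_(0 <= k <oo) (c k)%:E <= 1 ->
    (0 < z)%R -> (z <= 1)%R ->
    exists2 d : R, (0 <= d <= z ^+ m.+1)%R &
    \sum_(0 <= k <oo) (z ^+ k * c k)%:E =
    (\sum_(0 <= k < m) (z ^+ k * c k) + z ^+ m * c m + d)%:E.
  move=> c0 c1 z0 z1.
  have T0 : 0 <= \sum_(m.+1 <= k <oo) (z ^+ k * c k)%:E.
    by apply: nneseries_ge0 => k _ _; rewrite lee_fin mulr_ge0// exprn_ge0 ?ltW.
  have T1 := power_series_tail_le m.+1 c0 c1 (ltW z0) z1.
  have Tf : \sum_(m.+1 <= k <oo) (z ^+ k * c k)%:E \is a fin_num.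
    by rewrite ge0_fin_numE// (le_lt_trans T1)// ltry.
  exists (fine (\sum_(m.+1 <= k <oo) (z ^+ k * c k)%:E)).
    by rewrite -!lee_fin fineK// T0.
  rewrite (@nneseries_split _ _ 0 m.+1); last first.
    by move=> k _; rewrite lee_fin mulr_ge0// exprn_ge0 ?ltW.
  by rewrite add0n big_nat_recr//= sumEFin EFinD fineK// EFinD.
apply/eqP; rewrite -subr_eq0 -normr_eq0 eq_le normr_ge0 andbT.
apply/ler_addgt0Pr => e e0; rewrite add0r.
pose z : R := Num.min e 1%R; have z0 : (0 < z)%R by rewrite lt_min e0 ltr01.
have z1 : (z <= 1)%R by rewrite ge_min lexx orbT.
apply: (@le_trans _ _ z); last by rewrite ge_min lexx.
have [d /andP[d0 d1] ad] := split a z a0 a1 z0 z1.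
have [d' /andP[d'0 d'1] bd] := split b z b0 b1 z0 z1.
move: (ab z z0 z1); rewrite ad bd => -[].
rewrite (eq_big_nat _ _ (F2 := fun k => z ^+ k * b k)%R); last first.
  by move=> i /andP[_ im]; rewrite IH.
rewrite -!addrA => /addrI eq1.
have zm0 : (0 < z ^+ m)%R by rewrite exprn_gt0.
rewrite -(ler_pM2l zm0) -[leRHS]exprSr -[X in (X * _)%R]ger0_norm ?(ltW zm0)// -normrM.
rewrite mulrBr.
have -> : (z ^+ m * a m - z ^+ m * b m = d' - d)%R by move: eq1; lra.
by rewrite ler_norml; apply/andP; split; lra.
Qed.
End power_series.

Section generating_functions.
Local Open Scope ereal_scope.
Context {R : realType}.

Lemma measurable_preim_eq d (T : measurableType d) (X : T -> nat) k :
  measurable_fun setT X -> measurable [set w | X w = k].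
Proof. by move=> mX; rewrite -[X in measurable X]setTI; exact: (mX measurableT [set k]). Qed.

Lemma measurable_prod_exprn d (T : measurableType d) (X : nat -> T -> nat)
    (z : nat -> R) (s : seq nat) :
  (forall i, i \in s -> measurable_fun setT (X i)) ->
  measurable_fun setT (fun w => \prod_(i <- s) z i ^+ X i w)%R.
Proof.
elim: s => [_|i s IH ms].
  by under eq_fun do rewrite big_nil; exact: measurable_cst.
under eq_fun do rewrite big_cons; apply: measurable_funM; last first.
  by apply: IH => j js; apply: ms; rewrite inE js orbT.
by apply: (measurableT_comp (f := fun n : nat => z i ^+ n)%R) => //;
  apply: ms; rewrite inE eqxx.
Qed.

Lemma prod_exprn_itv d (T : measurableType d) (X : nat -> T -> nat)
    (z : nat -> R) (s : seq nat) w :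
  (forall i, 0 < z i <= 1)%R -> (0 <= \prod_(i <- s) z i ^+ X i w <= 1)%R.
Proof.
move=> z01; rewrite prodr_ge0/=; last first.
  by move=> i _; have /andP[? ?] := z01 i; rewrite exprn_ge0 ?ltW.
apply: prodr_ile1 => i _; have /andP[? ?] := z01 i.
by apply/andP; split; [apply: exprn_ge0|apply: exprn_ile1] => //; exact: ltW.
Qed.

Lemma integral_exprn d (T : measurableType d) (P : {measure set T -> \bar R})
    (X : T -> nat) (Y : T -> R) (D : set T) (z : R) :
  measurable D -> measurable_fun setT X -> measurable_fun setT Y ->
  (forall w, 0 <= Y w)%R -> (0 <= z)%R ->
  \int[P]_(w in D) (z ^+ X w * Y w)%:E =
  \sum_(0 <= k <oo)
    (z ^+ k)%:E * \int[P]_(w in D `&` [set w | X w = k]) (Y w)%:E.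
Proof.
move=> mD mX mY Y0 z0; have mXk k := measurable_preim_eq k mX.
have Dcup : D = \bigcup_k (D `&` [set w | X w = k]).
  by rewrite -setI_bigcupr; apply/seteqP; split => [w Dw|w []//]; split => //; exists (X w).
rewrite {1}Dcup ge0_integral_bigcup//=.
- apply: eq_eseriesr => k _.
  under eq_integral => w /[!inE] -[_ /= ->] do rewrite EFinM.
  rewrite ge0_integralZl_EFin ?exprn_ge0//.
  + exact: measurableI.
  + by move=> w _; rewrite lee_fin.
  + by apply/measurable_EFinP; exact: measurable_funTS.
- by move=> k; exact: measurableI.
- rewrite -Dcup; apply/measurable_EFinP/measurable_funTS/measurable_funM => //.
  exact: (measurableT_comp (f := fun n : nat => z ^+ n)%R).
- by move=> w _; rewrite lee_fin mulr_ge0 ?exprn_ge0.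
- by apply/trivIsetP => i j _ _ ij; apply/seteqP; split => // w [[_ /= ->] [_ /= /eqP]]; rewrite (negbTE ij).
Qed.

Context d d' (T : measurableType d) (T' : measurableType d').
Context (P : probability T R) (P' : probability T' R).

(** Extracts one coordinate. The set [D] and the weight [Y] leave room for an induction: [D] carries
    the coordinates whose values are already fixed, [Y] the powers attached to the remaining ones.
    The coefficients of the power series in z are the integrals of [Y] over the events [X = k] in
    [D]; they sum to at most 1 since [Y <= 1]. *)
Lemma generating_function_unique1 (X : T -> nat) (X' : T' -> nat)
    (Y : T -> R) (Y' : T' -> R) (D : set T) (D' : set T') :
  measurable D -> measurable D' ->
  measurable_fun setT X -> measurable_fun setT X' ->
  measurable_fun setT Y -> measurable_fun setT Y' ->
  (forall w, 0 <= Y w <= 1)%R -> (forall w, 0 <= Y' w <= 1)%R ->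
  (forall z : R, (0 < z <= 1)%R -> \int[P]_(w in D) (z ^+ X w * Y w)%:E =
                         \int[P']_(w in D') (z ^+ X' w * Y' w)%:E) ->
  forall k, \int[P]_(w in D `&` [set w | X w = k]) (Y w)%:E =
            \int[P']_(w in D' `&` [set w | X' w = k]) (Y' w)%:E.
Proof.
move=> mD mD' mX mX' mY mY' Y01 Y'01 eqz k.
have gen d0 (T0 : measurableType d0) (P0 : probability T0 R) (X0 : T0 -> nat)
  (Y0 : T0 -> R) (D0 : set T0) : measurable D0 -> measurable_fun setT X0 ->
  measurable_fun setT Y0 -> (forall w, 0 <= Y0 w <= 1)%R ->
  [/\ (forall k, \int[P0]_(w in D0 `&` [set w | X0 w = k]) (Y0 w)%:E \is a fin_num),
     (forall k, 0 <= fine (\int[P0]_(w in D0 `&` [set w | X0 w = k]) (Y0 w)%:E))%R,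
     \sum_(0 <= k <oo) (fine (\int[P0]_(w in D0 `&` [set w | X0 w = k]) (Y0 w)%:E))%:E <= 1
   & forall z, (0 <= z)%R -> \int[P0]_(w in D0) (z ^+ X0 w * Y0 w)%:E =
     \sum_(0 <= k <oo) (z ^+ k * fine (\int[P0]_(w in D0 `&` [set w | X0 w = k]) (Y0 w)%:E))%:E].
  move=> mD0 mX0 mY0 Y001.
  have Y00 w : (0 <= Y0 w)%R by have /andP[] := Y001 w.
  have bnd A : measurable A -> 0 <= \int[P0]_(w in A) (Y0 w)%:E <= 1.
    move=> mA; apply/andP; split; first by apply: integral_ge0 => w _; rewrite lee_fin.
    apply: (@le_trans _ _ (\int[P0]_(w in A) 1)).
      apply: ge0_le_integral => //.
      - by move=> w _; rewrite lee_fin.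
      - by apply/measurable_EFinP; exact: measurable_funTS.
      - by move=> w _; rewrite lee_fin; have /andP[] := Y001 w.
    by rewrite integral_cst// mul1e probability_le1.
  have mDk j : measurable (D0 `&` [set w | X0 w = j]).
    by apply: measurableI => //; exact: measurable_preim_eq.
  have fin j : \int[P0]_(w in D0 `&` [set w | X0 w = j]) (Y0 w)%:E \is a fin_num.
    have /andP[? ?] := bnd _ (mDk j).
    by rewrite ge0_fin_numE// (@le_lt_trans _ _ 1)// ltry.
  have eqs z : (0 <= z)%R -> \int[P0]_(w in D0) (z ^+ X0 w * Y0 w)%:E =
     \sum_(0 <= k <oo) (z ^+ k * fine (\int[P0]_(w in D0 `&` [set w | X0 w = k]) (Y0 w)%:E))%:E.
    move=> z0; rewrite integral_exprn//; apply: eq_eseriesr => j _.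
    by rewrite EFinM fineK.
  split => //.
    by move=> j; apply: fine_ge0; have /andP[] := bnd _ (mDk j).
  have /andP[_] := bnd _ mD0; apply: le_trans.
  under eq_eseriesr => j _ do rewrite -[X in X%:E]mul1r -(expr1n _ j).
  rewrite -eqs// le_eqVlt; apply/orP; left; apply/eqP.
  by apply: eq_integral => w _; rewrite expr1n mul1r.
have [f1 g1 s1 e1] := gen _ _ P _ _ _ mD mX mY Y01.
have [f2 g2 s2 e2] := gen _ _ P' _ _ _ mD' mX' mY' Y'01.
rewrite -[LHS]fineK// -[RHS]fineK//; congr _%:E; move: k.
apply: power_series_unique => // z z0 z1.
by rewrite -e1 ?ltW// -e2 ?ltW// eqz// z0.
Qed.

(** Powers become events one coordinate at a time: after m rounds the first m coordinates are fixed
    by the domain of integration and only the others appear in the product. *)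
Lemma generating_function_unique (n : nat) (X : nat -> T -> nat)
    (X' : nat -> T' -> nat) :
  (forall i, (i < n)%N -> measurable_fun setT (X i)) ->
  (forall i, (i < n)%N -> measurable_fun setT (X' i)) ->
  (forall z : nat -> R, (forall i, 0 < z i <= 1)%R ->
    \int[P]_w (\prod_(0 <= i < n) z i ^+ X i w)%:E =
    \int[P']_w (\prod_(0 <= i < n) z i ^+ X' i w)%:E) ->
  forall k : nat -> nat,
    P [set w | forall i, (i < n)%N -> X i w = k i] =
    P' [set w | forall i, (i < n)%N -> X' i w = k i].
Proof.
move=> mX mX' eqz k.
pose E m := [set w | forall i, (i < m)%N -> X i w = k i].
pose E' m := [set w | forall i, (i < m)%N -> X' i w = k i].
have ES (U : Type) (Z : nat -> U -> nat) m :
    [set w | forall i, (i < m.+1)%N -> Z i w = k i] =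
    [set w | forall i, (i < m)%N -> Z i w = k i] `&` [set w | Z m w = k m].
  apply/seteqP; split => w /= => [H|[H1 H2] i]; first by split => [i im|]; apply: H; rewrite // ltnW.
  by rewrite ltnS leq_eqVlt => /predU1P[->//|]; exact: H1.
have mE d0 (T0 : measurableType d0) (Z : nat -> T0 -> nat) : (forall i, (i < n)%N -> measurable_fun setT (Z i)) ->
   forall m, (m <= n)%N -> measurable [set w | forall i, (i < m)%N -> Z i w = k i].
  move=> mZ; elim=> [_|m IH mn]; first by rewrite (_ : [set _ | _] = setT)//; apply/seteqP; split.
  by rewrite ES; apply: measurableI; [exact/IH/ltnW|apply: measurable_preim_eq; exact: mZ].
suff H m : (m <= n)%N -> forall z : nat -> R, (forall i, 0 < z i <= 1)%R ->
    \int[P]_(w in E m) (\prod_(m <= i < n) z i ^+ X i w)%:E =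
    \int[P']_(w in E' m) (\prod_(m <= i < n) z i ^+ X' i w)%:E.
  have := H n (leqnn n) (fun=> 1%R); rewrite ltr01 lexx => /(_ (fun=> isT)).
  under eq_integral do rewrite big_geq//.
  under [X in _ = X -> _]eq_integral do rewrite big_geq//.
  by rewrite !integral_cst ?mul1e//; apply: mE.
elim: m => [_ z z01|m IH mn z z01].
  rewrite (_ : E 0%N = setT); last by apply/seteqP; split.
  rewrite (_ : E' 0%N = setT); last by apply/seteqP; split.
  exact: eqz.
rewrite /E /E' !ES.
apply: generating_function_unique1.
- by apply: mE => //; exact: ltnW.
- by apply: mE => //; exact: ltnW.
- exact: mX.
- exact: mX'.
- by apply: measurable_prod_exprn => i; rewrite mem_index_iota => /andP[_]; exact: mX.
- by apply: measurable_prod_exprn => i; rewrite mem_index_iota => /andP[_]; exact: mX'.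
- by move=> w; exact: prod_exprn_itv.
- by move=> w; exact: prod_exprn_itv.
move=> y y01.
(* The induction hypothesis is used at z with its m-th entry replaced by the free variable y, which
   isolates the factor [y ^+ X m w]. *)
have zy i : (0 < (if i == m then y else z i) <= 1)%R by case: ifP.
have := IH (ltnW mn) _ zy.
have cut d0 (T0 : measurableType d0) (Z : nat -> T0 -> nat) w :
   (\prod_(m <= i < n) (if i == m then y else z i) ^+ Z i w = y ^+ Z m w * \prod_(m.+1 <= i < n) z i ^+ Z i w)%R.
  rewrite big_ltn// eqxx; congr *%R; apply: eq_big_nat => i /andP[mi _].
  by rewrite gtn_eqF.
under eq_integral do rewrite cut.
by under [X in _ = X -> _]eq_integral do rewrite cut.
Qed.

Lemma countable_law_eq (I : countType) (V : T -> I) (V' : T' -> I) :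
  (forall c, measurable [set w | V w = c]) ->
  (forall c, measurable [set w | V' w = c]) ->
  (forall c, P [set w | V w = c] = P' [set w | V' w = c]) ->
  forall B : set I, P (V @^-1` B) = P' (V' @^-1` B).
Proof.
move=> mV mV' eqV B.
pose F U (W : U -> I) j := [set w | B (W w) /\ pickle (W w) = j].
have FE U (W : U -> I) j : F U W j = match pickle_inv j with
    | Some c => if `[<B c>] then [set w | W w = c] else set0 | None => set0 end.
  case ej : pickle_inv => [c|].
    have pc : pickle c = j by have := @pickle_invK I j; rewrite /oapp ej.
    case: asboolP => Bc; apply/seteqP; split => // w.
    - by move=> [_]; rewrite -pc => /(pcan_inj pickleK).
    - by move=> /= wc; rewrite /F /= wc.
    - by move=> [BW]; rewrite -pc => /(pcan_inj pickleK) wc; apply: Bc; rewrite -wc.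
  apply/seteqP; split => // w [_ wj].
  by move: ej; rewrite -wj pickleK_inv.
have mF d0 (T0 : measurableType d0) (W : T0 -> I) : (forall c, measurable [set w | W w = c]) ->
    forall j, measurable (F T0 W j).
  by move=> mW j; rewrite FE; case: pickle_inv => // c; case: ifP.
have cup U (W : U -> I) : W @^-1` B = \bigcup_j F U W j.
  by apply/seteqP; split => [w Bw|w [j _ []//]]; exists (pickle (W w)).
have tF U (W : U -> I) : trivIset setT (F U W).
  by apply/trivIsetP => i j _ _ ij; apply/seteqP; split => // w [[_ wi] [_ wj]];
    move: ij; rewrite -wi -wj eqxx.
rewrite !cup !measure_bigcup//=; [|by move=> j _; exact: mF|by move=> j _; exact: mF].
apply: eq_eseriesr => j _; rewrite !FE; case: pickle_inv => [c|]; last by rewrite !measure0.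
by case: ifP; rewrite ?measure0.
Qed.

(** Coding the vector as a sequence of naturals makes its range a countable type, so that equality
    of point masses extends to every set [B]. *)
Lemma generating_function_law_eq (n : nat) (X : nat -> T -> nat)
    (X' : nat -> T' -> nat) :
  (forall i, (i < n)%N -> measurable_fun setT (X i)) ->
  (forall i, (i < n)%N -> measurable_fun setT (X' i)) ->
  (forall z : nat -> R, (forall i, 0 < z i <= 1)%R ->
    \int[P]_w (\prod_(0 <= i < n) z i ^+ X i w)%:E =
    \int[P']_w (\prod_(0 <= i < n) z i ^+ X' i w)%:E) ->
  forall B : set (seq nat),
    P [set w | B (mkseq (X ^~ w) n)] = P' [set w | B (mkseq (X' ^~ w) n)].
Proof.
move=> mX mX' eqz B.
have mkE U (Z : nat -> U -> nat) (c : seq nat) : [set w | mkseq (Z ^~ w) n = c] =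
   if size c == n then [set w | forall i, (i < n)%N -> Z i w = nth 0%N c i] else set0.
  case: ifP => cn; apply/seteqP; split => // w /=.
  - by move=> <- i ni; rewrite nth_mkseq.
  - move=> H; apply: (@eq_from_nth _ 0%N); rewrite size_mkseq ?(eqP cn)// => i ni.
    by rewrite nth_mkseq// H.
  - by move=> H; move: cn; rewrite -H size_mkseq eqxx.
have mE d0 (T0 : measurableType d0) (Z : nat -> T0 -> nat) : (forall i, (i < n)%N -> measurable_fun setT (Z i)) ->
   forall c, measurable [set w | mkseq (Z ^~ w) n = c].
  move=> mZ c; rewrite mkE; case: ifP => // _.
  rewrite (_ : [set _ | _] = \bigcap_(i in [set i | (i < n)%N]) [set w | Z i w = nth 0%N c i]); last first.
    by apply/seteqP; split.
  by apply: bigcap_measurableType => i ni; apply: measurable_preim_eq; exact: mZ.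
apply: (@countable_law_eq _ (fun w => mkseq (X ^~ w) n) (fun w => mkseq (X' ^~ w) n)).
- exact: mE.
- exact: mE.
- by move=> c; rewrite !mkE; case: ifP; rewrite ?measure0// => _; exact: generating_function_unique.
Qed.

End generating_functions.

Section measurable_nat_valued.
Context {d : measure_display} {T : measurableType d}.

Lemma measurable_preim_nat (X : T -> nat) (B : set nat) :
  measurable_fun setT X -> measurable [set w | B (X w)].
Proof. by move=> mX; rewrite -[X in measurable X]setTI; exact: (mX measurableT B). Qed.

Lemma measurable_fun_nat2 (f : nat -> nat -> nat) (X Y : T -> nat) :
  measurable_fun setT X -> measurable_fun setT Y ->
  measurable_fun setT (fun w => f (X w) (Y w)).
Proof.
move=> mX mY _ B _; rewrite setTI.
rewrite (_ : _ @^-1` B =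
    \bigcup_i ([set w | X w = i] `&` [set w | B (f i (Y w))])).
  apply: bigcup_measurable => i _; apply: measurableI.
    exact: (measurable_preim_nat [set i] mX).
  exact: (measurable_preim_nat [set j | B (f i j)] mY).
apply/seteqP; split => w /=; first by move=> Bw; exists (X w).
by move=> [i _ [/= ->]].
Qed.
End measurable_nat_valued.

(** * Erlang integrals *)

Section erlang_integral.
Context {R : realType}.
Implicit Types (c t : R) (i : nat).

Lemma exprn_expRN_cvg0 c i : 0 < c ->
  t ^+ i * expR (- (c * t)) @[t --> +oo] --> 0.
Proof.
move=> c0; apply/cvgrPdist_le => e e0; near=> t.
have t0 : 0 < t by near: t; exact: nbhs_pinfty_gt.
rewrite sub0r normrN ger0_norm; last by rewrite mulr_ge0 ?expR_ge0// exprn_ge0 ?ltW.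
(* With (i+1) s = c t, the inequality exp(c t) = exp(s)^(i+1) >= s^(i+1) gives a power of t one
   degree higher than the one to be beaten. *)
pose s := c * t / i.+1%:R.
have s0 : 0 < s by rewrite divr_gt0// mulr_gt0.
have es : s ^+ i.+1 <= expR (c * t).
  rewrite (_ : c * t = i.+1%:R * s); last by rewrite /s mulrCA mulfV ?mulr1// pnatr_eq0.
  rewrite expRM_natl lerXn2r ?nnegrE ?expR_ge0 ?(ltW s0)//.
  by apply: le_trans (expR_ge1Dx s); rewrite lerDr.
rewrite expRN ler_pdivrMr ?expR_gt0//; apply: (@le_trans _ _ (e * s ^+ i.+1)); last first.
  by rewrite ler_pM2l.
have -> : e * s ^+ i.+1 = e * t * (c / i.+1%:R) ^+ i.+1 * t ^+ i.
  by rewrite /s mulrAC exprMn (exprS t); ring.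
rewrite ler_peMl ?exprn_ge0 ?(ltW t0)//.
have ek0 : 0 < e * (c / i.+1%:R) ^+ i.+1 by rewrite mulr_gt0// exprn_gt0// divr_gt0.
rewrite mulrAC -ler_pdivrMl// mulr1.
Unshelve. all: by end_near. Qed.

(** Iterated integration by parts; the integration constants make it vanish at +oo. *)
Fixpoint erlang_primitive c i t : R :=
  if i isn't j.+1 then - expR (- (c * t)) / c else
  (erlang_primitive c j t - t ^+ i / i`!%:R * expR (- (c * t))) / c.

Lemma is_derive_erlang_primitive c i t : 0 < c ->
  is_derive t 1 (erlang_primitive c i) (t ^+ i / i`!%:R * expR (- (c * t))).
Proof.
move=> c0.
have dE : is_derive t 1 (fun t => expR (- (c * t))) (expR (- (c * t)) * - c).
  apply: (@is_derive1_comp _ expR (fun t => - (c * t))).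
  by apply: is_derive_eq; rewrite /GRing.scale/= mulr1.
elim: i => [|i IH] /=.
  rewrite (_ : (fun _ => _) = (fun t => - c^-1 *: expR (- (c * t)))); last first.
    by apply/funext => x; rewrite /GRing.scale/= mulNr mulrC mulNr.
  apply: is_derive_eq; rewrite /GRing.scale/= expr0 fact0 divr1 mul1r.
  by field; rewrite gt_eqF.
rewrite (_ : (fun _ => _) = (fun t => c^-1 *: (erlang_primitive c i t -
    i.+1`!%:R^-1 *: (t ^+ i.+1 * expR (- (c * t)))))); last first.
  by apply/funext => x; rewrite /GRing.scale/=; ring.
have fE : i`!%:R^-1 = (i.+1)`!%:R^-1 * i.+1%:R :> R.
  by rewrite factS natrM invfM mulrAC mulVf ?mul1r// pnatr_eq0.
move: IH; rewrite fE; move: (i.+1`!%:R^-1) => b.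
move: (erlang_primitive c i) => F IH.
have dX : is_derive t 1 (fun t : R => t ^+ i.+1) (i.+1%:R * t ^+ i).
  have := @is_deriveX _ _ (@id R) i.+1 t 1 1 (is_derive_id _ _).
  rewrite exprfctE /GRing.scale/= => h; apply: (@is_derive_eq _ _ _ _ _ _ _ _ h).
  by rewrite mulr1.
have dXE := is_deriveM dX dE.
have dZ := is_deriveZ c^-1 (is_deriveB IH (is_deriveZ b dXE)).
apply: (@is_derive_eq _ _ _ _ _ _ _ _ dZ).
rewrite /GRing.scale/= (exprS t).
by field; rewrite gt_eqF.
Qed.

Lemma erlang_primitive0 c i : erlang_primitive c i 0 = - c^-1 ^+ i.+1.
Proof.
elim: i => [|i IH] /=; first by rewrite mulr0 oppr0 expR0 expr1 mulN1r.
by rewrite IH expr0n/= !mul0r subr0 mulNr -exprSr.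
Qed.

Lemma erlang_primitive_cvg0 c i : 0 < c -> erlang_primitive c i t @[t --> +oo] --> 0.
Proof.
move=> c0; elim: i => [|i IH] /=.
  rewrite (_ : (fun _ => _) = (fun t => - c^-1 * (t ^+ 0 * expR (- (c * t))))); last first.
    by apply/funext => x; rewrite expr0 mul1r mulNr mulrC mulNr.
  rewrite -(mulr0 (- c^-1)); apply: cvgMr; exact: exprn_expRN_cvg0.
rewrite (_ : (fun _ => _) = (fun t => c^-1 * (erlang_primitive c i t -
    i.+1`!%:R^-1 * (t ^+ i.+1 * expR (- (c * t)))))); last first.
  by apply/funext => x; ring.
rewrite [X in _ --> X](_ : _ = c^-1 * (0 - i.+1`!%:R^-1 * 0)); last by rewrite !mulr0 subr0 mulr0.
apply: cvgMr.
apply: cvgB => //; apply: cvgMr; exact: exprn_expRN_cvg0.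
Qed.

Lemma integral_erlang c i : 0 < c ->
  (\int[@lebesgue_measure R]_(t in `[0%R, +oo[) (t ^+ i / i`!%:R * expR (- (c * t)))%:E =
  (c^-1 ^+ i.+1)%:E)%E.
Proof.
move=> c0; have dF t := is_derive_erlang_primitive i t c0.
rewrite (@ge0_continuous_FTC2y _ _ (erlang_primitive c i) 0 0).
- by rewrite erlang_primitive0 -EFinB opprK add0r.
- by move=> t t0; rewrite mulr_ge0 ?expR_ge0// divr_ge0// exprn_ge0.
- apply: continuous_subspaceT => t.
  apply: cvgM; first by apply: cvgMl; exact: exprn_continuous.
  apply: continuous_comp; last exact: continuous_expR.
  by apply: cvgN; apply: cvgMr.
- exact: erlang_primitive_cvg0.
- by move=> t _; exact: ex_derive.
- apply: cvg_at_right_filter; apply: differentiable_continuous.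
  by apply/derivable1_diffP; exact: ex_derive.
- by move=> t _; rewrite derive1E; exact: derive_val.
Qed.
End erlang_integral.

(** * Generating functions of independent Poisson counts *)

Section poisson_generating_function.
Local Open Scope ereal_scope.
Context {R : realType} {d : measure_display} {T : measurableType d}.
Variable P : probability T R.

Lemma nneseries_exp_coeff (x : R) : (0 <= x)%R ->
  \sum_(0 <= k <oo) (x ^+ k / k`!%:R)%:E = (expR x)%:E.
Proof.
move=> x0; rewrite expRE -EFin_lim; last first.
  rewrite /pseries/=; under eq_fun do rewrite mulrC.
  exact: is_cvg_series_exp_coeff.
apply/congr_lim/funext => n/=; rewrite /pseries/= /series/= -sumEFin//.
by under eq_bigr do rewrite mulrC.
Qed.

Lemma generating_function_poisson (X : T -> nat) (mu z : R) :
  measurable_fun setT X -> (0 <= mu)%R -> (0 <= z)%R ->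
  (forall k, P [set w | X w = k] = (mu ^+ k / k`!%:R * expR (- mu))%:E) ->
  \int[P]_w (z ^+ X w)%:E = (expR (- ((1 - z) * mu)))%:E.
Proof.
move=> mX mu0 z0 PX.
under eq_integral => w _ do rewrite -[(z ^+ _)%R]mulr1.
rewrite (@integral_exprn _ _ _ P X (fun=> 1%R))//.
transitivity (\sum_(0 <= k <oo) ((expR (- mu))%:E * ((z * mu) ^+ k / k`!%:R)%:E)).
  apply: eq_eseriesr => k _; rewrite setTI integral_cst; last exact: measurable_preim_eq.
  transitivity ((z ^+ k)%:E * P [set w | X w = k]); first by rewrite mul1e.
  rewrite PX.
  by rewrite -!EFinM exprMn; congr _%:E; ring.
rewrite nneseriesZl; last by move=> k _; rewrite lee_fin divr_ge0// exprn_ge0// mulr_ge0.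
rewrite nneseries_exp_coeff ?mulr_ge0// -EFinM -expRD; congr (expR _)%:E; ring.
Qed.

(** Independence is assumed for events; each induction step replaces the event [X m = k] by the
    power of z by summing over k. The mixed form, events below m and powers from m on, serves later
    to keep an event of the past next to the increments of the future. *)
Lemma independent_generating_function n (X : nat -> T -> nat)
    (B : nat -> set nat) (z g : nat -> R) :
  (forall i, (i < n)%N -> measurable_fun setT (X i)) ->
  (forall B : nat -> set nat, P [set w | forall i, (i < n)%N -> B i (X i w)] =
    \prod_(0 <= i < n) P [set w | B i (X i w)]) ->
  (forall i, 0 < z i <= 1)%R ->
  (forall i, (i < n)%N -> \int[P]_w (z i ^+ X i w)%:E = (g i)%:E) ->
  forall m, (m <= n)%N ->
  \int[P]_(w in [set w | forall i, (i < m)%N -> B i (X i w)])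
     (\prod_(m <= i < n) z i ^+ X i w)%:E =
  \prod_(0 <= i < m) P [set w | B i (X i w)] * (\prod_(m <= i < n) g i)%:E.
Proof.
move=> mX indX z01 gE.
have mE m (B0 : nat -> set nat) : (m <= n)%N -> measurable [set w | forall i, (i < m)%N -> B0 i (X i w)].
  move=> mn; rewrite (_ : [set _ | _] = \bigcap_(i < m) [set w | B0 i (X i w)]).
    apply: bigcap_measurableType => i /= im.
    by rewrite -[X in measurable X]setTI; apply: (mX i _ measurableT (B0 i)) => //; exact: leq_trans mn.
  by apply/seteqP; split.
have mB i (B0 : set nat) : (i < n)%N -> measurable [set w | B0 (X i w)].
  by move=> ni; rewrite -[X in measurable X]setTI; apply: (mX i _ measurableT B0).
suff H j : (j <= n)%N -> forall B,
  \int[P]_(w in [set w | forall i, (i < n - j)%N -> B i (X i w)])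
     (\prod_(n - j <= i < n) z i ^+ X i w)%:E =
  \prod_(0 <= i < n - j) P [set w | B i (X i w)] * (\prod_(n - j <= i < n) g i)%:E.
  by move=> m mn; have := H (n - m)%N (leq_subr _ _) B; rewrite subKn.
elim: j => [_ B0|j IH jn B0].
  rewrite subn0; under eq_integral do rewrite big_geq//.
  by rewrite [X in _ * X%:E]big_geq// integral_cst; [rewrite mul1e mule1; exact: indX|exact: mE].
set m := (n - j.+1)%N; have nj : (n - j = m.+1)%N by rewrite /m; lia.
have mn : (m < n)%N by rewrite /m; lia.
rewrite nj in IH.
under eq_integral do rewrite big_ltn//.
rewrite integral_exprn//; first last.
- by have /andP[/ltW] := z01 m.
- by move=> w; have /andP[] := prod_exprn_itv X (index_iota m.+1 n) w z01.
- by apply: measurable_prod_exprn => i; rewrite mem_index_iota => /andP[_]; exact: mX.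
- exact: mX.
- by apply: mE; exact: ltnW.
have Pfin i (C : set nat) : (i < n)%N -> P [set w | C (X i w)] = (fine (P [set w | C (X i w)]))%:E.
  by move=> ni; rewrite fineK// fin_num_measure//; exact: mB.
pose c := (\prod_(0 <= i < m) fine (P [set w | B0 i (X i w)]))%R.
have cE : \prod_(0 <= i < m) P [set w | B0 i (X i w)] = c%:E.
  rewrite /c -prodEFin; apply: eq_big_nat => i /andP[_ im]; apply: Pfin.
  exact: ltn_trans mn.
have gm := gE m mn.
have := gm; under eq_integral => w _ do rewrite -[(z m ^+ _)%R]mulr1.
rewrite (@integral_exprn _ _ _ P (X m) (fun=> 1%R))//; [|exact: mX|by have /andP[/ltW] := z01 m].
move=> gm'.
rewrite cE [in RHS]big_ltn// EFinM -gm' muleA muleAC -EFinM.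
rewrite -nneseriesZl; last first.
  by move=> k _; rewrite mule_ge0// ?lee_fin ?exprn_ge0//; [have /andP[/ltW] := z01 m|apply: integral_ge0 => w _; rewrite lee_fin].
apply: eq_eseriesr => k _.
rewrite setTI integral_cst; last exact: (mB m [set k]).
rewrite mul1e [RHS]muleCA; congr (_ * _).
have := IH (ltnW jn) (fun i => if i == m then [set k] else B0 i).
rewrite [in RHS]big_nat_recr//= eqxx.
have -> : \prod_(0 <= i < m) P [set w | (if i == m then [set k] else B0 i) (X i w)] = c%:E.
  by rewrite -cE; apply: eq_big_nat => i /andP[_ im]; rewrite ltn_eqF.
have -> : [set w | forall i, (i < m.+1)%N -> (if i == m then [set k] else B0 i) (X i w)] =
   [set w | forall i, (i < m)%N -> B0 i (X i w)] `&` [set w | X m w = k].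
  apply/seteqP; split => w /= => [H|[H1 H2] i].
    split; last by have := H m (leqnn _); rewrite eqxx.
    by move=> i im; have := H i (ltnW im); rewrite ltn_eqF.
  rewrite ltnS leq_eqVlt => /predU1P[->|im]; first by rewrite eqxx.
  by rewrite ltn_eqF//; exact: H1.
move=> ->; rewrite EFinM.
by rewrite muleAC.
Qed.
End poisson_generating_function.

(** The summands are the Erlang integrals met in the Laplace transform of the r-th point; the sum
    telescopes. *)
Lemma sum_geometric_odds (R : realType) (l : R) n : 0 < 1 + l ->
  \sum_(0 <= i < n) l * (1 + l)^-1 ^+ i.+1 = 1 - (1 + l)^-1 ^+ n.
Proof.
move=> l1; elim: n => [|n IH]; first by rewrite big_nil expr0 subrr.
by rewrite big_nat_recr//= IH !exprS; field; rewrite gt_eqF.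
Qed.

Section laplace_ccdf.
Local Open Scope ereal_scope.
Context {R : realType} {d : measure_display} {T : measurableType d}.
Variable P : probability T R.

Lemma integral_exponential_itv (l b : R) : (0 < l)%R -> (0 <= b)%R ->
  \int[@lebesgue_measure R]_(t in `[0%R, b[) (l * expR (- (l * t)))%:E =
  (1 - expR (- (l * b)))%:E.
Proof.
move=> l0; rewrite le_eqVlt => /predU1P[<-|b0].
  by rewrite set_itvco0 integral_set0 mulr0 oppr0 expR0 subrr.
have dF (t : R) : is_derive t 1%R (fun t => - expR (- (l * t)))%R (l * expR (- (l * t)))%R.
  have dE : is_derive t 1%R (fun t => expR (- (l * t)))%R (expR (- (l * t)) * - l)%R.
    apply: (@is_derive1_comp _ expR (fun t => - (l * t)))%R.
    by apply: is_derive_eq; rewrite /GRing.scale/= mulr1.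
  by apply: is_derive_eq; rewrite mulrN opprK mulrC.
have cF : continuous (fun t : R => l * expR (- (l * t)))%R.
  move=> t; apply: cvgMr; apply: continuous_comp; last exact: continuous_expR.
  by apply: cvgN; apply: cvgMr.
rewrite integral_itv_bndo_bndc; last first.
  apply/measurable_EFinP; apply: measurable_funTS.
  exact: continuous_measurable_fun.
rewrite (@continuous_FTC2 _ _ (fun t => - expR (- (l * t)))%R)//.
- by rewrite mulr0 oppr0 expR0 -EFinB; congr _%:E; ring.
- exact: continuous_subspaceT.
- have cF' : continuous (fun t : R => - expR (- (l * t)))%R.
    move=> t; apply/differentiable_continuous/derivable1_diffP.
    exact: ex_derive.
  split; first by move=> t _; exact: ex_derive.
    by apply: cvg_at_right_filter; exact: cF'.
  by apply: cvg_at_left_filter; exact: cF'.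
- by move=> t _; rewrite derive1E; exact: derive_val.
Qed.

(** Write 1 - exp(-l X) as the integral of l exp(-l t) over 0 <= t < X and exchange the integrals.
    The law of X enters through its tail only, which for the r-th point is a Poisson probability. *)
Lemma laplace_ccdf (X : T -> R) (l : R) : measurable_fun setT X ->
  (forall w, 0 <= X w)%R -> (0 < l)%R ->
  \int[P]_w (1 - expR (- (l * X w)))%:E =
  \int[@lebesgue_measure R]_(t in `[0%R, +oo[)
    ((l * expR (- (l * t)))%:E * P [set w | (t < X w)%R]).
Proof.
move=> mX X0 l0.
pose A := [set x : T * R | (0 <= x.2 < X x.1)%R].
have mA : measurable A.
  rewrite (_ : A = (fun x : T * R => (0 <= x.2)%R && (x.2 < X x.1)%R) @^-1` [set true]) //.
  rewrite -[X in measurable X]setTI.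
  have mf : measurable_fun setT (fun x : T * R => (0 <= x.2)%R && (x.2 < X x.1)%R).
    apply: measurable_and.
      by apply: measurable_fun_ler => //; exact: measurable_snd.
    apply: measurable_fun_ltr; first exact: measurable_snd.
    exact: measurableT_comp mX measurable_fst.
  exact: (mf measurableT [set true]).
pose f (x : T * R) := (l * expR (- (l * x.2)) * \1_A x)%:E.
have f0 x : 0 <= f x by rewrite lee_fin mulr_ge0// mulr_ge0 ?expR_ge0// ltW.
have mE : measurable_fun setT (fun t : R => l * expR (- (l * t)))%R.
  apply: measurable_funM => //; apply: (measurableT_comp (f := @expR R)) => //.
  by apply: measurableT_comp => //; apply: measurable_funM.
have mf : measurable_fun setT f.
  apply/measurable_EFinP; apply: measurable_funM; last exact: measurable_indic.
  exact: (measurableT_comp mE measurable_snd).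
have := @fubini_tonelli _ _ _ _ _ P (@lebesgue_measure R) f mf f0.
have -> : \int[P]_w \int[lebesgue_measure]_t f (w, t) = \int[P]_w (1 - expR (- (l * X w)))%:E.
  apply: eq_integral => w _; rewrite -integral_exponential_itv//.
  rewrite [RHS]integral_mkcond; apply: eq_integral => t _.
  rewrite /f /patch /A indicE/=.
  have [H|/negP H] := boolP (0 <= t < X w)%R; first by rewrite !mem_set ?mulr1//= in_itv.
  by rewrite !memNset ?mulr0//= in_itv.
move=> ->; rewrite [RHS]integral_mkcond; apply: eq_integral => t _.
have [t0|/negP t0] := boolP (0 <= t)%R; last first.
  rewrite patchN; last by rewrite notin_setE/= in_itv/= andbT.
  apply: integral0_eq => w _; rewrite /f indicE memNset ?mulr0//.
  by move=> /= /andP[].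
rewrite patchT; last by rewrite inE/= in_itv/= t0.
rewrite /f/=; under eq_integral do rewrite EFinM.
have mt : measurable [set w | (t < X w)%R].
  rewrite -[X in measurable X]setTI.
  have : measurable_fun setT (fun w => t < X w)%R by exact: measurable_fun_ltr.
  by move=> /(_ measurableT [set true]); exact.
have iE w : (\1_A (w, t) = \1_[set w | (t < X w)%R] w :> R)%R.
  rewrite !indicE; have [H|/negP H] := boolP (t < X w)%R; first by rewrite !mem_set//=; apply/andP.
  by rewrite !memNset// => /andP[_ /H].
under eq_integral do rewrite iE.
rewrite ge0_integralZl_EFin//.
- by rewrite integral_indic// setIT.
- by apply/measurable_EFinP; exact: measurable_indic.
- by rewrite mulr_ge0 ?expR_ge0// ltW.
Qed.
End laplace_ccdf.

(** * The r-th point of a unit-rate Poisson process *)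

Section poisson_process.
Local Open Scope ereal_scope.
Context {R : realType} {d : measure_display} {T : measurableType d}.
Variable P : probability T R.

(** The last clause is right continuity, in the form it takes for integer-valued paths. *)
Definition counting_path (k : R -> nat) : Prop :=
  [/\ k 0%R = 0%N,
      forall s t, (0 <= s)%R -> (s <= t)%R -> (k s <= k t)%N
    & forall t, (0 <= t)%R -> exists2 e, (0 < e)%R &
        forall s, (t <= s)%R -> (s <= t + e)%R -> k s = k t].

Definition unit_poisson_process (K : T -> R -> nat) : Prop :=
  [/\ forall w, counting_path (K w),
      forall t, (0 <= t)%R -> measurable_fun setT (K ^~ t),
      forall n (t : nat -> R), (0 <= t 0%N)%R -> (forall i, t i <= t i.+1)%R ->
        forall B : nat -> set nat,
        P [set w | forall i, (i < n)%N -> B i (K w (t i.+1) - K w (t i))%N] =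
        \prod_(0 <= i < n) P [set w | B i (K w (t i.+1) - K w (t i))%N]
    & forall s t, (0 <= s)%R -> (s <= t)%R -> forall k,
        P [set w | (K w t - K w s = k)%N] =
        ((t - s) ^+ k / k`!%:R * expR (- (t - s)))%:E].

Variables (K : T -> R -> nat) (r : nat) (Gamma : T -> R).
Hypothesis ppK : unit_poisson_process K.
Hypothesis r_gt0 : (0 < r)%N.

Let Kmono w s t : (0 <= s)%R -> (s <= t)%R -> (K w s <= K w t)%N.
Proof. by move=> s0 st; have [/(_ w)[_ + _] _ _ _] := ppK; apply. Qed.

Let K0 w : K w 0%R = 0%N.
Proof. by have [/(_ w)[]] := ppK. Qed.

Let mK t : (0 <= t)%R -> measurable_fun setT (K ^~ t).
Proof. by have [_ + _ _] := ppK; exact. Qed.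

Let mKge t k : (0 <= t)%R -> measurable [set w | (k <= K w t)%N].
Proof. by move=> t0; exact: (measurable_preim_nat [set j | (k <= j)%N] (mK t0)). Qed.

Lemma measurable_increment s t : (0 <= s)%R -> (0 <= t)%R ->
  measurable_fun setT (fun w => K w t - K w s)%N.
Proof. by move=> s0 t0; exact: (measurable_fun_nat2 subn (mK t0) (mK s0)). Qed.

(** The event that there are at least r points. [Gamma] is constrained only there, and it has
    probability 1. *)
Definition reached : set T := [set w | exists n : nat, (r <= K w n%:R)%N].

Lemma poisson_le_tail (t : R) : (0 <= t)%R ->
  P [set w | (K w t < r)%N] = (\sum_(0 <= i < r) t ^+ i / i`!%:R * expR (- t))%:E.
Proof.
move=> t0.
have -> : [set w | (K w t < r)%N] = \bigcup_(i < r) [set w | (K w t - K w 0%R = i)%N].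
  apply/seteqP; split => w /= => [Kr|[i /= ir]]; last by rewrite K0 subn0 => ->.
  by exists (K w t) => //=; rewrite K0 subn0.
rewrite bigcup_mkord (measure_bigsetU _ (F := fun i => [set w | (K w t - K w 0%R)%N = i])).
- rewrite -sumEFin big_mkord; apply: eq_bigr => i _.
  have [_ _ _ PK] := ppK; apply: (etrans (PK _ _ (lexx 0%R) t0 _)).
  by rewrite subr0.
- by move=> i; apply: measurable_preim_eq; exact: measurable_increment.
- by apply/trivIsetP => i j _ _ ij; apply/seteqP; split => // w [/= -> /eqP]; rewrite (negbTE ij).
Qed.

(** The count at time N has parameter N, and each of the r terms N^i / i! exp(-N) tends to 0. *)
Lemma poisson_lt_small (e : R) : (0 < e)%R ->
  exists N : nat, P [set w | (K w N%:R < r)%N] <= e%:E.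
Proof.
move=> e0.
have H i : (N%:R ^+ i / i`!%:R * expR (- N%:R) : R)%R @[N --> \oo] --> 0%R.
  under eq_fun do rewrite mulrAC.
  rewrite -(mul0r (i`!%:R^-1)%R); apply: cvgMl.
  have := @exprn_expRN_cvg0 R 1 i ltr01.
  under eq_fun do rewrite mul1r.
  by move=> h; exact: (cvg_comp _ _ cvgr_idn h).
have : \forall N \near \oo, forall i : 'I_r, (N%:R ^+ i / i`!%:R * expR (- N%:R) < e / r%:R)%R.
  apply: filter_forall => i; apply: cvgr_lt (H i) _ _; rewrite divr_gt0// ltr0n//.
move=> [N _ /(_ N (leqnn N)) HN]; exists N.
rewrite poisson_le_tail ?ler0n// lee_fin big_mkord.
apply: (@le_trans _ _ (\sum_(i < r) e / r%:R)%R); first by apply: ler_sum => i _; exact/ltW/HN.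
by rewrite sumr_const card_ord -[leLHS]mulr_natr divfK// pnatr_eq0 -lt0n.
Qed.

Hypothesis hGamma : forall w, reached w -> forall t, (0 <= t)%R ->
  (Gamma w <= t)%R = (r <= K w t)%N.

Lemma Gamma_gt0 w : reached w -> (0 < Gamma w)%R.
Proof. by move=> rw; rewrite ltNge hGamma// K0 -ltnNge. Qed.

Lemma measurable_reached : measurable reached.
Proof.
have -> : reached = \bigcup_i [set w | (r <= K w i%:R)%N].
  by apply/seteqP; split => [w [i ?]|w [i _ ?]]; exists i.
by apply: bigcup_measurable => i _; exact: mKge.
Qed.

Lemma probability_reached : P reached = 1.
Proof.
apply/eqP; rewrite eq_le probability_le1//=; last exact: measurable_reached.
apply/lee_addgt0Pr => e e0; have [N PN] := poisson_lt_small e0.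
have <- : P setT = 1 by exact: probability_setT.
have -> : [set: T] = reached `|` [set w | (K w N%:R < r)%N].
  by apply/seteqP; split => // w _; case: (leqP r (K w N%:R)) => H; [left; exists N|right].
have mN : measurable [set w | (K w N%:R < r)%N].
  by apply: (measurable_preim_nat [set j | (j < r)%N] (mK _)).
apply: (le_trans (measureU2 P measurable_reached mN)).
exact: leeD.
Qed.

(* The stopping time [Gamma] rounded up to the grid of mesh 1/(m+1). *)
Let D (m : nat) w : R := ((Num.ceil (m.+1%:R * Gamma w))%:~R / m.+1%:R)%R.
(** The r-th point lies in the cell ]k/(m+1), (k+1)/(m+1)]. There [D m] is the right end of the
    cell, and membership is decided by the path up to that time. *)
Let E (m k : nat) : set T :=
  [set w | (r <= K w (k.+1%:R / m.+1%:R))%N] `\` [set w | (r <= K w (k%:R / m.+1%:R))%N].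

Let mE m k : measurable (E m k).
Proof. by apply: measurableD; apply: mKge. Qed.

Let trivIsetE m : trivIset setT (E m).
Proof.
apply/trivIsetP => i j _ _; wlog ij : i j / (i < j)%N => [H|_].
  rewrite neq_ltn => /orP[ij|ji]; first by apply: H => //; rewrite ltn_eqF.
  by rewrite setIC; apply: H => //; rewrite ltn_eqF.
apply/seteqP; split => // w [[/= wi _] [_ /=]]; apply.
by apply: (leq_trans wi); apply: Kmono => //; rewrite ler_pM2r ?invr_gt0// ler_nat.
Qed.

Let ED m k w : E m k w -> reached w /\ D m w = (k.+1%:R / m.+1%:R)%R.
Proof.
move=> [/= wk /negP wNk].
have rw : reached w.
  exists k.+1; apply: (leq_trans wk); apply: Kmono => //.
  by rewrite ler_pdivrMr// ler_peMr// ler1n.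
split => //; rewrite /D (@ceil_def _ _ k.+1)//.
have -> : (k.+1%:Z - 1 = k%:Z)%R by lia.
rewrite -!pmulrn.
rewrite mulrC -ltr_pdivrMr// -ler_pdivlMr//.
by rewrite ltNge !hGamma// wNk.
Qed.

Let reached_bigcupE m : reached = \bigcup_k E m k.
Proof.
apply/seteqP; split => w; last by move=> [k _ /ED[]].
move=> rw; have G0 := Gamma_gt0 rw.
have : (0 < Num.ceil (m.+1%:R * Gamma w))%R by rewrite ceil_gt0 mulr_gt0.
have := ceil_itv (m.+1%:R * Gamma w)%R.
case: (Num.ceil _) => // -[//|k] /andP[k1 k2] _.
exists k => //; split => /=.
  by rewrite -hGamma// ler_pdivlMr// mulrC.
apply/negP; rewrite -hGamma// -ltNge ltr_pdivrMr// mulrC.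
by move: k1; have -> : (k.+1%:Z - 1 = k%:Z)%R by lia.
Qed.

Lemma measurable_fun_discretized (m : nat) (F : T -> R -> R) :
  (forall t, (0 <= t)%R -> measurable_fun setT (F ^~ t)) ->
  measurable_fun reached (fun w => F w (D m w)).
Proof.
move=> mF; rewrite (reached_bigcupE m); apply/measurable_fun_bigcup => // k.
apply: (eq_measurable_fun (F ^~ (k.+1%:R / m.+1%:R)%R)).
  by move=> w /[!inE] /ED[_ ->].
by apply: measurable_funTS; apply: mF.
Qed.

(** Trades the random time for countably many deterministic ones, to which the independence of
    increments applies. *)
Lemma integral_discretized (m : nat) (F : T -> R -> R) :
  (forall t, (0 <= t)%R -> measurable_fun setT (F ^~ t)) ->
  (forall w t, 0 <= F w t)%R ->
  \int[P]_(w in reached) (F w (D m w))%:E =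
  \sum_(0 <= k <oo) \int[P]_(w in E m k) (F w (k.+1%:R / m.+1%:R))%:E.
Proof.
move=> mF F0; rewrite {1}(reached_bigcupE m) ge0_integral_bigcup//=.
- apply: eq_eseriesr => k _; apply: eq_integral => w /[!inE] wE.
  by rewrite (ED wE).2.
- by rewrite -reached_bigcupE; apply/measurable_EFinP; exact: measurable_fun_discretized.
- by move=> w _; rewrite lee_fin.
Qed.

Let D_ge m w : (Gamma w <= D m w)%R.
Proof. by rewrite ler_pdivlMr// mulrC ceil_ge. Qed.

Let D_le m w : (D m w <= Gamma w + m.+1%:R^-1)%R.
Proof.
rewrite ler_pdivrMr// mulrDl mulVf// -lerBlDr mulrC.
by have := ceilB1_lt (Gamma w * m.+1%:R)%R; rewrite intrB mulr1z => /ltW.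
Qed.

Let D_near (e : R) w : (0 < e)%R -> \forall m \near \oo, (D m w <= Gamma w + e)%R.
Proof.
move=> e0; near=> m; apply: (le_trans (D_le m w)); rewrite lerD2l.
by near: m; apply: filterS (near_infty_natSinv_lt (PosNum e0)) => m /ltW.
Unshelve. all: by end_near. Qed.

Let D_cvg w : D m w @[m --> \oo] --> Gamma w.
Proof.
apply/cvgrPdist_le => e e0; near=> m.
rewrite ler0_norm ?subr_le0// opprB lerBlDl; near: m; exact: D_near.
Unshelve. all: by end_near. Qed.

(** [D m] approaches [Gamma] from above, so right continuity makes the two counts equal, and not
    merely close, for large m. *)
Let K_near w (a : R) : reached w -> (0 < a)%R ->
  \forall m \near \oo, K w (a * D m w)%R = K w (a * Gamma w)%R.
Proof.
move=> rw a0; have [/(_ w)[_ _ +] _ _ _] := ppK.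
have aG : (0 <= a * Gamma w)%R by rewrite mulr_ge0 ?ltW// Gamma_gt0.
move=> /(_ _ aG)[e e0 He]; have ea0 : (0 < e / a)%R by rewrite divr_gt0.
near=> m; apply: He; first by rewrite ler_pM2l.
have -> : (a * Gamma w + e = a * (Gamma w + e / a))%R.
  by rewrite mulrDr [(a * (e / a))%R]mulrC divfK// gt_eqF.
by rewrite ler_pM2l//; near: m; exact: D_near.
Unshelve. all: by end_near. Qed.

Lemma measurable_Gamma : measurable_fun reached Gamma.
Proof.
apply: (@measurable_fun_cvg _ _ _ _ D) => [m|w _]; last exact: D_cvg.
exact: (measurable_fun_discretized m (F := fun _ t => t)).
Qed.

Lemma measurable_fun_at_Gamma (a : R) : (0 < a)%R ->
  measurable_fun reached (fun w => K w (a * Gamma w)%R).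
Proof.
move=> a0.
have mR : measurable_fun reached (fun w => (K w (a * Gamma w))%:R : R)%R.
  apply: (@measurable_fun_cvg _ _ _ _ (fun m w => (K w (a * D m w))%:R : R)%R).
    move=> m; apply: (measurable_fun_discretized m (F := fun w t => (K w (a * t))%:R : R)%R).
    move=> t t0; apply: (measurableT_comp (f := fun k : nat => k%:R : R)) => //.
    by apply: mK; rewrite mulr_ge0// ltW.
  by move=> w rw; apply: cvg_near_cst; have := K_near rw a0; apply: filterS => m ->.
move=> mr B _.
rewrite (_ : _ `&` _ = \bigcup_(k in B) (reached `&` (fun w => (K w (a * Gamma w))%:R : R)%R @^-1` [set k%:R%R])).
  by apply: bigcup_measurable => k _; exact: mR.
apply/seteqP; split => w /=.
  by move=> [rw BK]; exists (K w (a * Gamma w)%R).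
by move=> [k Bk [rw /= /eqP]]; rewrite eqr_nat => /eqP ->.
Qed.

(** [Gamma] exceeds t exactly when fewer than r points are counted at t, an event whose probability
    is a sum of r Poisson terms. The i-th term times l exp(-l t) integrates to l / (1 + l)^(i+1),
    and summing over i < r gives 1 - (1 + l)^-r, the integral of 1 - exp(-l Gamma). *)
Lemma laplace_Gamma (l : R) : (0 <= l)%R ->
  \int[P]_(w in reached) (expR (- (l * Gamma w)))%:E = ((1 + l)^-1 ^+ r)%:E.
Proof.
have mr := measurable_reached; have Pr := probability_reached.
rewrite le_eqVlt => /predU1P[<-|l0].
  rewrite addr0 invr1 expr1n; under eq_integral do rewrite mul0r oppr0 expR0.
  by rewrite integral_cst// mul1e; exact: Pr.
have mG0 := (measurable_restrictT Gamma mr).1 measurable_Gamma.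
(* Extended by 0 off [reached], to have a nonnegative function on the whole space. *)
pose G : T -> R := Gamma \_ reached.
have mG : measurable_fun setT G by [].
have G0 w : (0 <= G w)%R.
  by rewrite /G /patch; case: ifPn => //; rewrite inE => /Gamma_gt0/ltW.
have PNr : P (~` reached) = 0 by rewrite probability_setC// Pr subee.
have PG t : (0 <= t)%R -> P [set w | (t < G w)%R] = P [set w | (K w t < r)%N].
  move=> t0.
  have mKt : measurable [set w | (K w t < r)%N].
    exact: (measurable_preim_nat [set j | (j < r)%N] (mK t0)).
  have -> : [set w | (t < G w)%R] = [set w | (K w t < r)%N] `&` reached.
    apply/seteqP; split => w /=; rewrite /G.
      have [rw|rw] := pselect (reached w).
        by rewrite patchT ?inE// ltNge hGamma// -ltnNge.
      by rewrite patchN ?notin_setE// ltNge t0.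
    by move=> [Kr rw]; rewrite patchT ?inE// ltNge hGamma// -ltnNge.
  rewrite -[in RHS](setIT [set w | (K w t < r)%N]) -(setUv reached) setIUr measureU//.
  - rewrite [X in _ + X](_ : _ = 0) ?adde0//.
    apply/eqP; rewrite eq_le measure_ge0 andbT -[leRHS]PNr; apply: le_measure; rewrite ?inE//.
    - by apply: measurableI => //; exact: measurableC.
    - exact: measurableC.
  - exact: measurableI.
  - by apply: measurableI => //; exact: measurableC.
  - by rewrite setIACA setICr setI0.
have lG := laplace_ccdf P mG G0 l0.
have l1 : (0 < 1 + l)%R by rewrite ltr_wpDr// ltW.
have RHSE : \int[lebesgue_measure]_(t in `[0%R, +oo[) ((l * expR (- (l * t)))%:E * P [set w | (t < G w)%R])
   = (1 - (1 + l)^-1 ^+ r)%:E.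
  transitivity (\int[@lebesgue_measure R]_(t in `[0%R, +oo[)
      (\sum_(0 <= i < r) (l%:E * (t ^+ i / i`!%:R * expR (- ((1 + l) * t)))%:E))).
    apply: eq_integral => t; rewrite inE/= in_itv/= andbT => t0.
    rewrite PG// poisson_le_tail// -EFinM mulr_sumr -sumEFin; apply: eq_bigr => i _.
    rewrite -EFinM; congr _%:E; rewrite mulrDl mul1r opprD expRD; ring.
  rewrite ge0_integral_sum//; first last.
  - by move=> i t; rewrite /= in_itv/= andbT => t0; rewrite -EFinM lee_fin !mulr_ge0 ?expR_ge0 ?exprn_ge0 ?(ltW l0)//.
  - move=> i; apply/measurable_EFinP; apply: measurable_funM => //.
    apply: measurable_funTS; apply: continuous_measurable_fun.
    move=> t; apply: cvgM; first by apply: cvgMl; exact: exprn_continuous.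
    apply: continuous_comp; last exact: continuous_expR.
    by apply: cvgN; apply: cvgMr.
  under eq_bigr => i _.
    rewrite ge0_integralZl_EFin//; first last.
    - exact: ltW.
    - apply/measurable_EFinP; apply: measurable_funTS; apply: continuous_measurable_fun.
      move=> t; apply: cvgM; first by apply: cvgMl; exact: exprn_continuous.
      apply: continuous_comp; last exact: continuous_expR.
      by apply: cvgN; apply: cvgMr.
    - by move=> t; rewrite /= in_itv/= andbT => t0; rewrite lee_fin !mulr_ge0 ?expR_ge0 ?exprn_ge0//.
    rewrite integral_erlang// -EFinM; over.
  by rewrite sumEFin sum_geometric_odds.
have GE : \int[P]_(w in reached) (expR (- (l * Gamma w)))%:E = \int[P]_w (expR (- (l * G w)))%:E.
  rewrite -[in RHS](setUv reached) ge0_integral_setU//; first last.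
  - exact/disj_setPCl.
  - rewrite setUv; apply/measurable_EFinP; apply: (measurableT_comp (f := @expR R)) => //.
    by apply: measurableT_comp => //; apply: measurable_funM.
  - exact: measurableC.
  rewrite [X in _ = _ + X](_ : _ = 0) ?adde0.
    by apply: eq_integral => w rw; rewrite /G patchT.
  rewrite (eq_integral (cst 1%E)) ?integral_cst ?mul1e//; last 2 first.
  - exact: measurableC.
  - by move=> w; rewrite inE => rw; rewrite /G patchN ?notin_setE// mulr0 oppr0 expR0.
rewrite RHSE in lG; rewrite GE.
have mX : measurable_fun setT (fun w => expR (- (l * G w)) : R)%R.
  apply: (measurableT_comp (f := @expR R)) => //.
  by apply: measurableT_comp => //; apply: measurable_funM.
have X1 w : (expR (- (l * G w)) <= 1)%R.
  by rewrite -expR0 ler_expR oppr_le0 mulr_ge0// ltW.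
have : \int[P]_w (1 - expR (- (l * G w)))%:E + \int[P]_w (expR (- (l * G w)))%:E = 1.
  rewrite -ge0_integralD//.
  - transitivity (\int[P]_w (cst 1%E) w); last by rewrite integral_cst// mul1e; exact: probability_setT.
    by apply: eq_integral => w _; rewrite -EFinD subrK.
  - by move=> w _; rewrite lee_fin subr_ge0.
  - by apply/measurable_EFinP; apply: measurable_funB.
  - exact/measurable_EFinP.
rewrite lG => /(congr1 (fun x => x - (1 - (1 + l)^-1 ^+ r)%:E)).
by rewrite addeAC subee// add0e => ->; rewrite -EFinB; congr _%:E; ring.
Qed.

(** With m = t - s, the bound exp(-m) >= 1 - m yields 1 - (1 + m) exp(-m) <= m^2. The quadratic
    order is what beats the number of cells in a union bound. *)
Lemma poisson_ge2_le (s t : R) : (0 <= s)%R -> (s <= t)%R ->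
  P [set w | (2 <= K w t - K w s)%N] <= ((t - s) ^+ 2)%:E.
Proof.
move=> s0 st; have t0 := le_trans s0 st; set m := (t - s)%R.
have m0 : (0 <= m)%R by rewrite subr_ge0.
have mI := measurable_increment s0 t0.
pose A k := [set w | (K w t - K w s = k)%N].
have mA k : measurable (A k) by exact: (measurable_preim_nat [set k] mI).
have -> : [set w | (2 <= K w t - K w s)%N] = ~` (A 0%N `|` A 1%N).
  apply/seteqP; split => w /=; rewrite /A /=; first by move=> H [] E'; rewrite E' in H.
  by case: (K w t - K w s)%N => [|[|k]]//; [case; left|case; right].
rewrite probability_setC ?measureU//; last first.
- exact: measurableU.
- by apply/seteqP; split => // w [/= E0 E1]; move: E1; rewrite /A /= E0.
have [_ _ _ PK] := ppK; rewrite [X in 1 - (X + _)](_ : _ = ((t - s) ^+ 0 / 0`!%:R * expR (- (t - s)))%:E); last exact: PK.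
rewrite [X in 1 - (_ + X)](_ : _ = ((t - s) ^+ 1 / 1`!%:R * expR (- (t - s)))%:E); last exact: PK.
rewrite -/m.
apply: (@le_trans _ _ ((1 - (m ^+ 0 / 0`!%:R * expR (- m) + m ^+ 1 / 1`!%:R * expR (- m)))%:E)); first exact: lexx.
rewrite lee_fin expr0 expr1 fact0 invr1 mulr1 mul1r.
have e1 := expR_ge1Dx (- m); have := expR_ge0 (- m).
nra.
Qed.

(* A jump of size at least two before time [N] falls in some cell of a grid of mesh [N/M],
   which has probability at most [M * (N/M)^2]. *)
Lemma Gamma_simple : P (reached `&` [set w | K w (Gamma w) = r]) = 1.
Proof.
have mr := measurable_reached; have Pr := probability_reached.
have mK1 := measurable_fun_at_Gamma ltr01.
have K1 w : K w (1 * Gamma w)%R = K w (Gamma w) by rewrite mul1r.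
have mB (B : set nat) : measurable (reached `&` [set w | B (K w (Gamma w))]).
  by have := mK1 mr B I; congr (measurable _); apply/seteqP; split => w [? /=]; rewrite K1.
pose B := reached `&` [set w | (r < K w (Gamma w))%N].
have mBB : measurable B := mB [set j | (r < j)%N].
suff PB : P B = 0.
  have rE : reached = (reached `&` [set w | K w (Gamma w) = r]) `|` B; last first.
    rewrite -Pr [in RHS]rE measureU//; last 2 first.
    - exact: (mB [set r]).
    - by apply/seteqP; split => // w [[_ /= Kr] [_ /=]]; rewrite Kr ltnn.
    by rewrite [X in _ = _ + X](_ : _ = 0) ?adde0//; exact: PB.
  apply/seteqP; split => w; last by case=> -[].
  move=> rw; have : (r <= K w (Gamma w))%N by rewrite -hGamma// ltW// Gamma_gt0.
  by rewrite leq_eqVlt => /predU1P[/esym rE|H]; [left|right].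
apply/eqP; rewrite eq_le measure_ge0 andbT; apply/lee_addgt0Pr => e e0; rewrite add0e.
have e20 : (0 < e / 2)%R by rewrite divr_gt0.
have [N PN] := poisson_lt_small e20.
(* More than N^2 / (e/2) cells, so that M cells of probability at most (N/M)^2 contribute at most
   e/2. *)
pose M := (Num.truncn (N%:R ^+ 2 / (e / 2) : R)%R).+1.
have M0 : (0 < M%:R :> R)%R by rewrite ltr0n.
have MN : (M%:R * (N%:R / M%:R) ^+ 2 <= e / 2 :> R)%R.
  have -> : (M%:R * (N%:R / M%:R) ^+ 2 = N%:R ^+ 2 / M%:R :> R)%R by field; rewrite gt_eqF.
  rewrite ler_pdivrMr// mulrC -ler_pdivrMr//; apply/ltW; exact: truncnS_gt.
pose s j : R := (j%:R * (N%:R / M%:R))%R.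
have s0 j : (0 <= s j)%R by rewrite mulr_ge0// divr_ge0.
have sS j : (s j <= s j.+1)%R by rewrite ler_wpM2r ?divr_ge0// ler_nat.
pose C j := [set w | (2 <= K w (s j.+1) - K w (s j))%N].
have mC j : measurable (C j).
  exact: (measurable_preim_nat [set k | (2 <= k)%N] (measurable_increment (s0 j) (s0 j.+1))).
have mN : measurable [set w | (K w N%:R < r)%N].
  exact: (measurable_preim_nat [set j | (j < r)%N] (mK (ler0n R N))).
(* When r points are counted at time N, consider the first grid time with at least r points: fewer
   than r are counted at the previous grid time, and at least K(Gamma) >= r + 1 at this one. *)
have sub : B `<=` [set w | (K w N%:R < r)%N] `|` \big[setU/set0]_(j < M) C j.
  move=> w [rw /= rK]; case: (ltnP (K w N%:R) r) => [|rN]; [by left|right].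
  rewrite -bigcup_mkord.
  have : exists j, (r <= K w (s j))%N.
    exists M; rewrite (_ : s M = N%:R)// /s mulrC divfK ?gt_eqF//.
  move=> /ex_minnP[[|j]]; first by rewrite /s mul0r K0 leqNgt r_gt0.
  move=> rj minj.
  have jM : (j < M)%N.
    apply: minj; rewrite (_ : s M = N%:R)// /s mulrC divfK ?gt_eqF//.
  exists j => //=; rewrite /C /=.
  have Kj : (K w (s j) < r)%N by rewrite ltnNge; apply/negP => /minj; rewrite ltnn.
  have : (K w (Gamma w) <= K w (s j.+1))%N.
    by apply: Kmono; [exact/ltW/Gamma_gt0|rewrite hGamma].
  lia.
apply: (@le_trans _ _ (P ([set w | (K w N%:R < r)%N] `|` \big[setU/set0]_(j < M) C j))).
  by apply: le_measure; rewrite ?inE//; apply: measurableU => //; exact: bigsetU_measurable.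
have mU : measurable (\big[setU/set0]_(j < M) C j) by exact: bigsetU_measurable.
apply: (le_trans (measureU2 P mN mU)).
rewrite [e in leRHS]splitr EFinD; apply: leeD => //.
apply: (le_trans (le_mu_bigsetU P _)) => //.
apply: (@le_trans _ _ (\sum_(j < M) ((N%:R / M%:R) ^+ 2)%:E)); last first.
  by rewrite sumEFin lee_fin sumr_const card_ord -[leLHS]mulr_natl.
apply: lee_sum => j _; apply: (le_trans (poisson_ge2_le (s0 j) (sS j))).
by rewrite lee_fin /s -mulrBl -natr1 addrAC subrr add0r mul1r.
Qed.

Variables (n : nat) (y z : nat -> R).
Hypothesis z01 : forall i, (0 < z i <= 1)%R.
Hypothesis y1 : (1 <= y 0%N)%R.
Hypothesis yS : forall i, (y i <= y i.+1)%R.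

Let lam := (\sum_(0 <= i < n) (1 - z i) * (y i.+1 - y i))%R.
Let inc w (t : R) i := (K w (y i.+1 * t) - K w (y i * t))%N.

Let y_gt0 i : (0 < y i)%R.
Proof.
apply: (@lt_le_trans _ _ (y 0%N)); first exact: lt_le_trans y1.
by elim: i => // i /le_trans; apply.
Qed.

Let measurable_inc t i : (0 <= t)%R -> measurable_fun setT (fun w => inc w t i).
Proof.
by move=> t0; apply: measurable_increment; rewrite mulr_ge0// ltW.
Qed.

(** The past is seen through one event at time s, the future through increments starting at y_0 t,
    which is at least s because y_0 >= 1. *)
Lemma poisson_process_past_future (s t : R) : (0 <= s)%R -> (s <= t)%R ->
  \int[P]_(w in [set w | (r <= K w s)%N]) (\prod_(0 <= i < n) z i ^+ inc w t i)%:E =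
  P [set w | (r <= K w s)%N] * (expR (- (lam * t)))%:E.
Proof.
move=> s0 st; have t0 := le_trans s0 st.
(* The times are 0, s, y_0 t, y_1 t and so on: the first increment carries the event, the second
   fills the gap and gets the neutral weight 1, and the windows start at index 2. *)
pose tau i := match i with 0%N => 0%R | 1%N => s | j.+2 => (y j * t)%R end.
have tau0 i : (0 <= tau i)%R by case: i => [|[|i]] //=; rewrite mulr_ge0// ltW.
have tauS i : (tau i <= tau i.+1)%R.
  case: i => [|[|i]] //=; last by rewrite ler_wpM2r.
  by rewrite (le_trans st)// ler_peMl.
pose X i w := (K w (tau i.+1) - K w (tau i))%N.
pose z' i := match i with j.+2 => z j | _ => 1%R end.
pose g i := expR (- ((1 - z' i) * (tau i.+1 - tau i))).
pose B i := match i with 0%N => [set k | (r <= k)%N] | _ => setT end.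
have mX i : measurable_fun setT (X i) by exact: measurable_increment.
have z'01 i : (0 < z' i <= 1)%R by case: i => [|[|i]] //=; rewrite ltr01 lexx.
have indX (B' : nat -> set nat) : P [set w | forall i, (i < n.+2)%N -> B' i (X i w)] =
    \prod_(0 <= i < n.+2) P [set w | B' i (X i w)].
  by have [_ _ + _] := ppK; apply.
have gE i : (i < n.+2)%N -> \int[P]_w (z' i ^+ X i w)%:E = (g i)%:E.
  move=> _; apply: generating_function_poisson => //.
  - by rewrite subr_ge0.
  - by have /andP[/ltW] := z'01 i.
  - by move=> k; have [_ _ _ ->] := ppK.
have := independent_generating_function B (fun i _ => mX i) indX z'01 gE (isT : (1 <= n.+2)%N).
rewrite !big_nat1.
have -> : [set w | forall i, (i < 1)%N -> B i (X i w)] = [set w | (r <= K w s)%N].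
  apply/seteqP; split => w /=; first by move=> /(_ 0%N isT); rewrite /= /X /= K0 subn0.
  by move=> rK [|//] _; rewrite /= /X /= K0 subn0.
have -> : [set w | B 0%N (X 0%N w)] = [set w | (r <= K w s)%N].
  by apply/seteqP; split => w /=; rewrite /X /= K0 subn0.
have -> : (\prod_(1 <= i < n.+2) g i = expR (- (lam * t)))%R.
  rewrite /lam big_ltn// [g 1%N]/g /= subrr mul0r oppr0 expR0 mul1r.
  rewrite big_add1/= big_add1/= mulr_suml -sumrN expR_sum big_nat [RHS]big_nat.
  apply: eq_bigr => i _; rewrite /g /=; congr expR; ring.
move=> <-.
apply: eq_integral => w _; congr _%:E.
by rewrite [RHS]big_ltn// [z' 1%N]/= expr1n mul1r big_add1/= big_add1/=.
Qed.

(** A cell event is the difference of the events that r points are reached by its right end t and by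
    its left end s. Both belong to the past of t and factorise with the same future increments, so
    the identity on the cell follows by subtraction. *)
Lemma strong_markov_discretized m :
  \int[P]_(w in reached) (\prod_(0 <= i < n) z i ^+ inc w (D m w) i)%:E =
  \int[P]_(w in reached) (expR (- (lam * D m w)))%:E.
Proof.
have mp t : (0 <= t)%R -> measurable_fun setT (fun w => \prod_(0 <= i < n) z i ^+ inc w t i)%R.
  by move=> t0; apply: (measurable_prod_exprn (X := fun i w => inc w t i)) => i _; exact: measurable_inc.
rewrite (@integral_discretized m (fun w t => \prod_(0 <= i < n) z i ^+ inc w t i)%R)//; last first.
  by move=> w t; apply: prodr_ge0 => i _; rewrite exprn_ge0//; have /andP[/ltW] := z01 i.
rewrite (@integral_discretized m (fun w t => expR (- (lam * t)))%R)//.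
apply: eq_eseriesr => k _.
pose s : R := (k%:R / m.+1%:R)%R; set t := (k.+1%:R / m.+1%:R)%R.
have s0 : (0 <= s)%R by rewrite /s.
have st : (s <= t)%R by rewrite ler_pM2r ?invr_gt0// ler_nat.
have t0 : (0 <= t)%R by rewrite /t.
rewrite integral_cst//.
have sub : [set w | (r <= K w s)%N] `<=` [set w | (r <= K w t)%N].
  by move=> w /= /leq_trans; apply; exact: Kmono.
have Us : [set w | (r <= K w t)%N] = [set w | (r <= K w s)%N] `|` E m k.
  by rewrite setDUK.
have disj : [disjoint [set w | (r <= K w s)%N] & E m k].
  by apply/disj_setPS => w [/= ? [_]].
have := poisson_process_past_future t0 (lexx t).
rewrite Us ge0_integral_setU//; first last.
- by move=> w _; rewrite lee_fin prodr_ge0// => i _; rewrite exprn_ge0//; have /andP[/ltW] := z01 i.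
- by apply/measurable_EFinP; apply: measurable_funTS; exact: mp.
- exact: mKge.
rewrite poisson_process_past_future// measureU//; [|exact: mKge|exact/disj_set2P].
rewrite ge0_muleDl//.
have fs : P [set w | (r <= K w s)%N] * (expR (- (lam * t)))%:E \is a fin_num.
  by rewrite fin_numM// fin_num_measure//; exact: mKge.
by move/(congr1 (fun x => x - P [set w | (r <= K w s)%N] * (expR (- (lam * t)))%:E));
  rewrite !(addeC (P [set w | (r <= K w s)%N] * _)) !addeK// => ->; rewrite muleC.
Qed.

Let inc_near w : reached w -> \forall m \near \oo, forall i : 'I_n, inc w (D m w) i = inc w (Gamma w) i.
Proof.
move=> rw; apply: filter_forall => i.
have := K_near rw (y_gt0 i); have := K_near rw (y_gt0 i.+1).
by apply: filterS2 => m; rewrite /inc => -> ->.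
Qed.

(** Dominated convergence from the grid, with bound 1: on the left the integrands are eventually
    constant in m, on the right they converge by continuity. The property is obtained in integrated
    form, without conditional laws. *)
Lemma strong_markov :
  \int[P]_(w in reached) (\prod_(0 <= i < n) z i ^+ inc w (Gamma w) i)%:E =
  \int[P]_(w in reached) (expR (- (lam * Gamma w)))%:E.
Proof.
have mr := measurable_reached.
have i1 : P.-integrable reached (cst 1%E).
  exact: finite_measure_integrable_cst.
have lam0 : (0 <= lam)%R.
  apply: sumr_ge0 => i _; rewrite mulr_ge0// subr_ge0//.
  by have /andP[] := z01 i.
have mp t : (0 <= t)%R -> measurable_fun setT (fun w => \prod_(0 <= i < n) z i ^+ inc w t i)%R.
  by move=> t0; apply: (measurable_prod_exprn (X := fun i w => inc w t i)) => i _; exact: measurable_inc.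
have c1 : (\int[P]_(w in reached) (\prod_(0 <= i < n) z i ^+ inc w (D m w) i)%:E) @[m --> \oo] -->
  \int[P]_(w in reached) (\prod_(0 <= i < n) z i ^+ inc w (Gamma w) i)%:E.
  apply: (@dominated_cvg _ _ _ _ _ mr _ _ (cst 1%E)) => //.
  - move=> m; apply/measurable_EFinP.
    exact: (measurable_fun_discretized m (F := fun w t => \prod_(0 <= i < n) z i ^+ inc w t i)%R).
  - move=> w rw; apply: cvg_near_cst; have := inc_near rw; apply: filterS => m H.
    by rewrite !big_mkord; congr _%:E; apply: eq_bigr => i _; rewrite H.
  - move=> m w _; have /andP[? ?] := prod_exprn_itv (fun i w => inc w (D m w) i) (index_iota 0 n) w z01.
    by rewrite gee0_abs lee_fin.
have c2 : (\int[P]_(w in reached) (expR (- (lam * D m w)))%:E) @[m --> \oo] -->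
  \int[P]_(w in reached) (expR (- (lam * Gamma w)))%:E.
  apply: (@dominated_cvg _ _ _ _ _ mr _ _ (cst 1%E)) => //.
  - move=> m; apply/measurable_EFinP.
    exact: (measurable_fun_discretized m (F := fun w t => expR (- (lam * t)))%R).
  - move=> w rw; apply: cvg_EFin; first by near=> m.
    apply: (@continuous_cvg _ _ _ _ _ _ (fun t => expR (- (lam * t)))); last exact: D_cvg.
    apply: continuous_comp; last exact: continuous_expR.
    by apply: cvgN; apply: cvgMr.
  - move=> m w rw; rewrite gee0_abs lee_fin ?expR_ge0// -expR0 ler_expR oppr_le0.
    by rewrite mulr_ge0// (le_trans (ltW (Gamma_gt0 rw))).
rewrite -(cvg_lim _ c1)// -(cvg_lim _ c2)//.
by apply: congr_lim; apply/funext => m; exact: strong_markov_discretized.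
Unshelve. all: by end_near. Qed.

End poisson_process.

(** * Ranked points and sums of jumps *)

Section ranked_points_theory.
Context {R : realType}.
Implicit Types (N : set R -> \bar R) (k : R -> nat).

(* [k x] is the number of points in [x, oo) of a configuration on (0, oo) that
   is finite on each of these intervals. *)
Definition tail_count k : Prop :=
  [/\ forall x y : R, 0 < x -> x <= y -> (k y <= k x)%N,
      forall x : R, 0 < x -> exists2 e : R, 0 < e & e < x /\
        forall y, x - e <= y -> y <= x -> k y = k x
    & exists2 b : R, 0 < b & k b = 0%N].

Lemma ranked_point_ge0 N i : 0 <= ranked_point N i.
Proof.
rewrite /ranked_point; set A := (X in sup X).
have [[[x Ax] ub]|] := pselect (has_sup A); last by move/sup_out => ->.
by apply: (le_trans (ltW Ax.1)); exact: (ub_le_sup ub).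
Qed.

(** All later work on ranks goes through this equivalence with counts. If the count at x is at most
    i, left continuity keeps it at most i on [x - e, x], so the supremum is at most x - e. An empty
    set is harmless, its supremum being 0 < x. *)
Lemma ranked_point_ge N k i x : tail_count k ->
  (forall x, 0 < x -> N `[x, +oo[%classic = (k x)%:R%:E) -> 0 < x ->
  (x <= ranked_point N i) = (i < k x)%N.
Proof.
move=> [mono left [b b0 kb]] Nk x0.
rewrite /ranked_point; set A := (X in sup X).
have AE y : A y <-> 0 < y /\ (i < k y)%N.
  rewrite /A /=; split => -[y0]; rewrite Nk// lee_fin ler_nat => H; split => //.
have ubA : ubound A b.
  move=> y /AE[y0 iky]; rewrite leNgt; apply/negP => /ltW /(mono _ _ b0).
  by rewrite kb leqn0 => /eqP ky; rewrite ky in iky.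
apply/idP/idP => [xA|ik]; last first.
  by apply: ub_le_sup; [exists b|apply/AE].
rewrite ltnNge; apply/negP => ki.
have A0 : A !=set0.
  apply/set0P/eqP => A0.
  by move: xA; rewrite A0 sup0 leNgt x0.
have [e e0 [ex He]] := left x x0.
suff : sup A <= x - e by move/(le_trans xA); rewrite lerBrDr gerDl leNgt e0.
apply: sup_le_ub => // y /AE[y0 iky]; rewrite leNgt; apply/negP => /ltW xy.
have [yx|/ltW yx] := leP y x.
  by move: iky; rewrite (He _ xy yx) ltnNge ki.
by have := leq_trans iky (leq_trans (mono _ _ x0 yx) ki); rewrite ltnn.
Qed.

Lemma finite_seq_gap (s : seq R) (x : R) :
  exists2 e : R, 0 < e & forall v, v \in s -> v != x -> e < `|v - x|.
Proof.
elim: s => [|u s [e e0 He]]; first by exists 1.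
have [->|ux] := eqVneq u x.
  exists e => // v; rewrite inE => /predU1P[->|]; first by rewrite eqxx.
  exact: He.
have d0 : 0 < `|u - x| / 2 by rewrite divr_gt0// normr_gt0 subr_eq0.
exists (Num.min e (`|u - x| / 2)); first by rewrite lt_min e0.
move=> v; rewrite inE => /predU1P[-> _|vs vx].
  by rewrite gt_min; apply/orP; right; lra.
by rewrite gt_min He.
Qed.

(** The multiplicity of x is the number of entries at least x minus the number at least x + e, when
    e is less than the distance from x to the other entries. *)
Lemma perm_eq_count_ge (s1 s2 : seq R) :
  (forall x, count (fun v => x <= v) s1 = count (fun v => x <= v) s2) ->
  perm_eq s1 s2.
Proof.
move=> eqc; apply/allP => x _ /=; apply/eqP.
have [e e0 He] := finite_seq_gap (s1 ++ s2) x.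
have cE (s : seq R) : {subset s <= s1 ++ s2} ->
    count (fun v => x <= v)%R s = (count_mem x s + count (fun v => x + e <= v)%R s)%N.
  elim: s => //= v s IH sub; rewrite IH; last by move=> u us; apply: sub; rewrite inE us orbT.
  have -> : ((x <= v)%R = (v == x) + (x + e <= v)%R :> nat)%N.
    have [->|vx] := eqVneq v x; first by rewrite lexx gerDl leNgt e0.
    have := He v (sub _ (mem_head _ _)) vx; rewrite add0n.
    by case: (lerP x v) => xv; case: (lerP (x + e) v) => // *; exfalso; lra.
  by rewrite addnACA.
have := eqc x; rewrite !cE; last 2 first.
- by move=> u us; rewrite mem_cat us orbT.
- by move=> u us; rewrite mem_cat us.
by rewrite eqc => /addIn.
Qed.

End ranked_points_theory.

(** * Laws on the space of sequences *)

Section sequence_laws_theory.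
Local Open Scope ereal_scope.
Context {R : realType}.

Definition seq_coordinates : set (set (nat -> R)) :=
  \bigcup_(i in [set: nat]) preimage_set_system setT (fun u : nat -> R => u i) measurable.

Lemma measurable_preim_seq d (T : measurableType d) (U : T -> nat -> R)
    (A : set (nat -> R)) :
  (forall i, measurable_fun setT (U ^~ i)) -> seq_measurable A ->
  measurable (U @^-1` A).
Proof.
move=> mU; apply: (smallest_sub (C := sigma_algebra setT) (X := fun A => measurable (U @^-1` A))).
  split.
  - by rewrite preimage_set0.
  - by move=> B mB; rewrite setTD -preimage_setC; exact: measurableC.
  - by move=> F mF; rewrite preimage_bigcup; exact: bigcup_measurable.
move=> _ [i _ [B mB <-]]; rewrite setTI.
by rewrite -[X in measurable X]setTI; exact: (mU i measurableT B).
Qed.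

(** Constraints are kept in a list, so that an intersection is a concatenation and these sets form a
    pi-system. *)
Definition lower_orthant (l : seq (nat * R)) : set (nat -> R) :=
  [set u | forall p, p \in l -> (p.2 <= u p.1)%R].

Lemma seq_measurable_lower_orthants :
  seq_measurable `<=` <<s [set lower_orthant l | l in [set: seq (nat * R)]] >>.
Proof.
set G := [set _ | _ in _].
apply: smallest_sub; first exact: smallest_sigma_algebra.
pose T0 : measurableType _ := g_sigma_algebraType G.
suff mc i : measurable_fun [set: T0] (fun u : T0 => (u : nat -> R) i).
  by move=> _ [i _ [B mB <-]]; exact: (mc i measurableT B mB).
apply: (measurability (@RGenCInfty.G R)); first exact: RGenCInfty.measurableE.
move=> _ [_ [x ->] <-]; rewrite setTI; apply: sub_sigma_algebra.
exists [:: (i, x)] => //; apply/seteqP; split => u /=; rewrite /lower_orthant /= in_itv/= andbT.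
  by move=> /(_ (i, x)); rewrite mem_head; exact.
by move=> xu p; rewrite inE => /eqP ->.
Qed.

(** Pi-lambda argument: the class [H] of sets with measurable preimages of equal probability is a
    Dynkin system. Measurability is part of [H] because complements and unions use it. *)
Lemma law_eq_lower_orthants d d' (T : measurableType d) (T' : measurableType d')
    (P : probability T R) (P' : probability T' R) (U : T -> nat -> R) (V : T' -> nat -> R) :
  (forall i, measurable_fun setT (U ^~ i)) ->
  (forall i, measurable_fun setT (V ^~ i)) ->
  (forall l, P (U @^-1` lower_orthant l) = P' (V @^-1` lower_orthant l)) ->
  forall A, seq_measurable A -> P (U @^-1` A) = P' (V @^-1` A).
Proof.
move=> mU mV UV A /seq_measurable_lower_orthants.
set G := [set _ | _ in _].
pose H := [set A | [/\ measurable (U @^-1` A), measurable (V @^-1` A) &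
   P (U @^-1` A) = P' (V @^-1` A)]].
suff : <<s G >> `<=` H by move=> /[apply] -[].
apply: lambda_system_subset => //.
- move=> _ _ [l _ <-] [l' _ <-]; exists (l ++ l') => //.
  apply/seteqP; split => u.
    by move=> H0; split => p pl; apply: H0; rewrite mem_cat pl ?orbT.
  by move=> [H1 H2] p; rewrite mem_cat => /orP[/H1|/H2].
- apply/dynkin_lambda_system; split.
  + by split; rewrite ?preimage_setT// !probability_setT.
  + move=> B [mUB mVB eB]; split.
    * by rewrite -preimage_setC; exact: measurableC.
    * by rewrite -preimage_setC; exact: measurableC.
    * by rewrite -(preimage_setC U B) -(preimage_setC V B) (probability_setC P mUB) (probability_setC P' mVB) eB.
  + move=> F tF HF.
    have mUF n : measurable (U @^-1` F n) by have [] := HF n.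
    have mVF n : measurable (V @^-1` F n) by have [] := HF n.
    have tpre (X : Type) (f : X -> nat -> R) : trivIset setT (fun n => f @^-1` F n).
      apply/trivIsetP => i j _ _ ij; rewrite -preimage_setI.
      by move/trivIsetP : tF => -> //; rewrite preimage_set0.
    split.
    * by rewrite preimage_bigcup; exact: bigcup_measurable.
    * by rewrite preimage_bigcup; exact: bigcup_measurable.
    * rewrite !preimage_bigcup !measure_bigcup//; apply: eq_eseriesr => n _.
      by have [] := HF n.
- move=> _ [l _ <-].
  have mL d0 (T0 : measurableType d0) (W : T0 -> nat -> R) :
      (forall i, measurable_fun setT (W ^~ i)) -> measurable (W @^-1` lower_orthant l).
    move=> mW; apply: measurable_preim_seq => //.
    have -> : lower_orthant l = \bigcap_(p in [set` l]) [set u | (p.2 <= u p.1)%R].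
      by apply/seteqP; split.
    apply: (@fin_bigcap_measurable _ (g_sigma_algebraType seq_coordinates)) => //.
    move=> p _; apply: sub_sigma_algebra; exists p.1 => //.
    exists `[p.2, +oo[%classic; first exact: measurable_itv.
    by rewrite setTI; apply/seteqP; split => u /=; rewrite in_itv/= andbT.
  by split; [exact: mL|exact: mL|exact: UV].
Qed.

(** The absolute values change nothing for ranked points, which are nonnegative, and give every
    sequence a total in [0, +oo], so that the map is measurable on the whole space. If the total is
    +oo, [fine] sends it to 0 and the ratios are 0. *)
Definition normalize_seq (u : nat -> R) : nat -> R :=
  fun j => (u j / fine (\sum_(0 <= i <oo) `|u i|%:E))%R.

Lemma seq_measurable_normalize (A : set (nat -> R)) : seq_measurable A ->
  seq_measurable (normalize_seq @^-1` A).
Proof.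
move=> mA; pose T0 : measurableType _ := g_sigma_algebraType seq_coordinates.
have mc i : measurable_fun [set: T0] (fun u : T0 => (u : nat -> R) i).
  by move=> _ B mB; apply: sub_sigma_algebra; exists i => //; exists B.
apply: (@measurable_preim_seq _ T0 normalize_seq A _ mA) => j.
apply: measurable_funM => //.
have -> : (fun u : T0 => (fine (\sum_(0 <= i <oo) `|(u : nat -> R) i|%:E))^-1%R) =
    (fun u : T0 => fine (\sum_(0 <= i <oo) `|(u : nat -> R) i|%:E) `^ (-1))%R.
  apply/funext => u; rewrite powR_inv1//; apply: fine_ge0.
  by apply: nneseries_ge0 => i _ _; rewrite lee_fin.
apply: (measurableT_comp (measurable_powR _)).
apply: (measurableT_comp (fine_measurable measurableT)).
apply: ge0_emeasurable_sum => [i u _ _|i _]; first by rewrite lee_fin.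
by apply/measurable_EFinP; exact: measurableT_comp.
Qed.

End sequence_laws_theory.

Lemma count_ltn_iota m n : count (fun i => i < m)%N (iota 0 n) = minn m n.
Proof.
elim: n => [|n IH]; first by rewrite minn0.
rewrite -addn1 iotaD count_cat IH /= add0n addn0; case: (ltnP n m) => /=; lia.
Qed.

Lemma ler_sum_subset (R : realDomainType) (T : eqType) (l1 l2 : seq T) (f : T -> R) :
  uniq l1 -> uniq l2 -> {subset l1 <= l2} -> {in l2, forall s, 0 <= f s} ->
  \sum_(s <- l1) f s <= \sum_(s <- l2) f s.
Proof.
move=> u1 u2 sub f0; rewrite [leRHS](bigID (fun s => s \in l1)) /=.
rewrite -[X in _ <= X + _]big_filter (perm_big l1 (r1 := [seq s <- l2 | s \in l1]))/=; last first.
  apply: uniq_perm => //; first exact: filter_uniq.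
  by move=> s; rewrite mem_filter; case: (boolP (s \in l1)) => // /sub ->.
rewrite lerDl big_seq_cond sumr_ge0// => s /andP[sl _]; exact: f0.
Qed.

(** * Ranking the jumps of a finite sum *)

Section summable_jumps.
Context {R : realType} {T : choiceType}.
Variables (D : set T) (f : T -> R) (S : R).
Hypothesis esumS : S%:E = (\esum_(s in D) (f s)%:E)%E.

Definition jumps_ge (x : R) : set T := [set s | D s /\ x <= f s].

Lemma sum_fset_le (l : seq T) : uniq l -> (forall s, s \in l -> D s) ->
  \sum_(s <- l) f s <= S.
Proof.
move=> ul lD; rewrite -lee_fin esumS; apply: ereal_sup_ubound.
exists [set` l]; first by split; [exact: finite_seq|].
by rewrite -sumEFin; apply/esym; rewrite fsbig_seq.
Qed.

(** Each of these jumps contributes at least x to a finite total, so there are at most S / x of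
    them. *)
Lemma finite_jumps_ge x : 0 < x -> finite_set (jumps_ge x).
Proof.
move=> x0; apply: contrapT => /infinite_set_fsetP inf.
have [B Bsub nB] := inf (Num.truncn (S / x)).+1.
have := @sum_fset_le (enum_fset B) (fset_uniq B).
move=> /(_ (fun s sB => (Bsub s sB).1)); apply/negP; rewrite -ltNge.
apply: (@lt_le_trans _ _ (\sum_(s <- enum_fset B) x)).
  rewrite big_const_seq count_predT iter_addr_0 -mulr_natl -ltr_pdivrMr//.
  by apply: (lt_le_trans (truncnS_gt _)); rewrite ler_nat.
by rewrite big_seq [leRHS]big_seq; apply: ler_sum => s sB; exact: (Bsub s sB).2.
Qed.

Definition jumps_count (x : R) : nat := #|` fset_set (jumps_ge x)|%fset.

Lemma mem_jumps_ge x s : 0 < x ->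
  (s \in fset_set (jumps_ge x)) = (s \in jumps_ge x).
Proof. by move=> x0; rewrite in_fset_set//; exact: finite_jumps_ge. Qed.

Lemma counting_jumps_ge x : 0 < x -> counting (jumps_ge x) = (jumps_count x)%:R%:E :> \bar R.
Proof. by move=> x0; rewrite /counting asboolT//; exact: finite_jumps_ge. Qed.

Lemma tail_count_jumps : tail_count jumps_count.
Proof.
have mono (x y : R) : 0 < x -> x <= y -> (jumps_count y <= jumps_count x)%N.
  move=> x0 xy; apply: fsubset_leq_card; apply/fsubsetP => s.
  rewrite !mem_jumps_ge//; last exact: lt_le_trans xy.
  by rewrite !inE => -[Ds ys]; split => //; exact: le_trans ys.
split => //.
- move=> x x0; have x20 : 0 < x / 2 by rewrite divr_gt0.
  (* Above x / 2 there are finitely many jumps; e isolates x from their other sizes, and the minimum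
     with x / 2 keeps the levels in that range. *)
  have [e e0 He] := finite_seq_gap [seq f s | s <- enum_fset (fset_set (jumps_ge (x / 2)))] x.
  exists (Num.min e (x / 2)); first by rewrite lt_min e0.
  split; first by rewrite gt_min; apply/orP; right; lra.
  move=> y xy yx; apply/eqP; rewrite eqn_leq andbC.
  have y2 : x / 2 <= y by apply: le_trans xy; rewrite lerBrDr -lerBrDl ge_min; apply/orP; right; lra.
  have y0 := lt_le_trans x20 y2.
  rewrite mono//=.
  apply: fsubset_leq_card; apply/fsubsetP => s; rewrite !mem_jumps_ge// !inE => -[Ds ys]; split => //.
  rewrite leNgt; apply/negP => sx.
  have sl : f s \in [seq f s | s <- enum_fset (fset_set (jumps_ge (x / 2)))].
    apply: map_f; rewrite mem_jumps_ge// inE; split => //; exact: le_trans ys.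
  have := He _ sl (negbT (lt_eqF sx)); rewrite ltr0_norm ?subr_lt0// opprB.
  apply/negP; rewrite -leNgt lerBlDr.
  have : x - Num.min e (x / 2) <= f s by exact: le_trans ys.
  by rewrite lerBlDr => /le_trans; apply; rewrite addrC lerD2r ge_min lexx.
- have S0 : 0 <= S by have := @sum_fset_le [::] isT; rewrite big_nil; apply.
  have S10 : 0 < S + 1 by rewrite ltr_wpDl.
  exists (S + 1) => //; apply/eqP; rewrite cardfs_eq0; apply/eqP/fsetP => s.
  rewrite mem_jumps_ge// inE; apply/negP; rewrite inE => -[Ds Ss].
  have := @sum_fset_le [:: s] isT; rewrite big_seq1 => H.
  have /H fS : forall u, u \in [:: s] -> D u by move=> u; rewrite inE => /eqP ->.
  by move: (le_trans Ss fS); rewrite gerDl ler10.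
Qed.

Variable rk : nat -> R.
Hypothesis rk0 : forall i, 0 <= rk i.
Hypothesis rkE : forall i x, 0 < x -> (x <= rk i) = (i < jumps_count x)%N.

(** Both sides sum the same multiset: for x >= e the two lists have equally many entries at least x,
    and for x < e all their entries are. *)
Lemma sum_rank_jumps_ge (e : R) : 0 < e ->
  \sum_(0 <= i < jumps_count e) rk i = \sum_(s <- enum_fset (fset_set (jumps_ge e))) f s.
Proof.
move=> e0; rewrite -(big_map f xpredT id) -(big_map rk xpredT id).
apply: perm_big; apply: perm_eq_count_ge => x; rewrite !count_map.
have [xe|ex] := ltP x e.
  rewrite (eq_in_count (a2 := xpredT)); last first.
    move=> i; rewrite mem_index_iota => /andP[_]; rewrite -rkE//= => ei.
    by rewrite (le_trans (ltW xe)).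
  rewrite [RHS](eq_in_count (a2 := xpredT)); last first.
    by move=> s; rewrite mem_jumps_ge// inE => -[_ es]; rewrite /= (le_trans (ltW xe)).
  by rewrite !count_predT size_iota subn0.
have x0 := lt_le_trans e0 ex.
rewrite (eq_in_count (a2 := fun i => i < jumps_count x)%N); last by move=> i _; rewrite /= rkE.
rewrite /index_iota subn0 count_ltn_iota (minn_idPl _); last first.
  by have [+ _ _] := tail_count_jumps; apply.
rewrite -size_filter; apply/perm_size/uniq_perm.
- exact: fset_uniq.
- by apply: filter_uniq; exact: fset_uniq.
move=> s; rewrite mem_filter !mem_jumps_ge//; apply/idP/andP; rewrite !inE.
  by move=> [Ds xs]; split => //; split => //; exact: le_trans xs.
by move=> [xs [Ds _]]; split.
Qed.

(** The ranks are known only through counts, so the jumps are not enumerated: the two sums are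
    compared above a level d, where they agree. The part of a finite sum below d is at most e when d
    is e divided by the number of terms plus 1. *)
Lemma sum_ranks : (\sum_(0 <= i <oo) (rk i)%:E = S%:E)%E.
Proof.
apply/eqP; rewrite eq_le; apply/andP; split.
  apply: lime_le; first by apply: is_cvg_nneseries => i _ _; rewrite lee_fin.
  apply: nearW => n; rewrite sumEFin lee_fin; apply/ler_addgt0Pr => e e0.
  pose d := e / n.+1%:R; have d0 : 0 < d by rewrite divr_gt0.
  apply: (@le_trans _ _ (\sum_(0 <= i < maxn n (jumps_count d)) rk i)).
    rewrite [leRHS](big_cat_nat (n := n))//= ?leq_maxl// lerDl.
    by apply: sumr_ge0 => i _.
  rewrite (big_cat_nat (n := jumps_count d))//= ?leq_maxr//; apply: lerD.
    rewrite sum_rank_jumps_ge//; apply: sum_fset_le; first exact: fset_uniq.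
    by move=> s; rewrite mem_jumps_ge// inE => -[].
  apply: (@le_trans _ _ (\sum_(jumps_count d <= i < maxn n (jumps_count d)) d)).
    apply: ler_sum_nat => i /andP[di _]; rewrite leNgt; apply/negP => /ltW.
    by rewrite rkE// ltnNge di.
  rewrite sumr_const_nat -mulr_natl /d mulrCA ler_piMr ?(ltW e0)//.
  by rewrite ler_pdivrMr// mul1r ler_nat; lia.
rewrite esumS; apply: ub_ereal_sup => _ [F [Ffin FD] <-].
have V0 := @nneseries_ge0 R (fun i => (rk i)%:E) xpredT 0%N (fun i _ _ => rk0 i).
rewrite fsbig_finite//= sumEFin; apply/lee_addgt0Pr => e e0.
set l := enum_fset (fset_set F).
pose d := e / (size l).+1%:R; have d0 : 0 < d by rewrite divr_gt0.
apply: (@le_trans _ _ (\sum_(s <- enum_fset (fset_set (jumps_ge d))) f s + e)%:E).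
  rewrite lee_fin (bigID (fun s => d <= f s))/=; apply: lerD.
    rewrite -big_filter; apply: ler_sum_subset.
    - by apply: filter_uniq; exact: fset_uniq.
    - exact: fset_uniq.
    - move=> s; rewrite mem_filter => /andP[ds]; rewrite in_fset_set// inE => Fs.
      by rewrite mem_jumps_ge// inE; split => //; exact: FD.
    - by move=> s; rewrite mem_jumps_ge// inE => -[_]; apply: le_trans; exact: ltW.
  apply: (@le_trans _ _ (\sum_(s <- l) d)).
    rewrite big_mkcond/=; apply: ler_sum => s _; case: ifPn => [|_]; last exact: ltW.
    by rewrite -ltNge => /ltW.
  rewrite big_const_seq count_predT iter_addr_0 -mulr_natl /d mulrCA ler_piMr ?(ltW e0)//.
  by rewrite ler_pdivrMr// mul1r ler_nat.
rewrite EFinD leeD2r// -sum_rank_jumps_ge// -sumEFin.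
by apply: nneseries_lim_ge => i _ _; rewrite lee_fin.
Qed.

End summable_jumps.

(** * Jumps of the stable subordinator *)

Lemma is_derive_continuous (R : realType) (g : R -> R) (x v : R) :
  is_derive x 1 g v -> {for x, continuous g}.
Proof.
move=> h; apply/differentiable_continuous/derivable1_diffP; exact: ex_derive.
Qed.

Section stable_intensity.
Context {R : realType}.
Variables (alpha C : R).
Hypotheses (alpha0 : 0 < alpha) (C0 : 0 < C).

(** The mass of [x, +oo[ under the Levy density. *)
Definition stable_tail (x : R) : R := C * x `^ (- alpha).

(** The inverse of [stable_tail] on the positive reals: the size above which t jumps are expected up
    to time 1. *)
Definition stable_level (t : R) : R := (t / C) `^ (- alpha^-1).

Lemma stable_tail_gt0 x : 0 < x -> 0 < stable_tail x.
Proof. by move=> x0; rewrite mulr_gt0// powR_gt0. Qed.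

Lemma stable_level_gt0 t : 0 < t -> 0 < stable_level t.
Proof. by move=> t0; rewrite powR_gt0// divr_gt0. Qed.

Lemma stable_levelK t : 0 < t -> stable_tail (stable_level t) = t.
Proof.
move=> t0; rewrite /stable_tail /stable_level -powRrM mulrNN mulVf ?gt_eqF//.
by rewrite powRr1 ?divr_ge0 ?ltW// mulrC divfK// gt_eqF.
Qed.

Lemma stable_tailK x : 0 < x -> stable_level (stable_tail x) = x.
Proof.
move=> x0; rewrite /stable_tail /stable_level [C * _]mulrC mulfK ?gt_eqF//.
by rewrite -powRrM mulrNN mulfV ?gt_eqF// powRr1// ltW.
Qed.

Lemma stable_tail_lt x y : 0 < x -> x < y -> stable_tail y < stable_tail x.
Proof.
move=> x0 xy; have y0 := lt_trans x0 xy.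
rewrite ltr_pM2l// !powRN ltf_pV2 ?posrE ?powR_gt0//.
by apply: gt0_ltr_powR; rewrite ?nnegrE ?(ltW x0) ?(ltW y0).
Qed.

Lemma stable_level_le t x : 0 < t -> 0 < x ->
  (stable_level t <= x) = (stable_tail x <= t).
Proof.
move=> t0 x0; rewrite -[in RHS](stable_levelK t0); have l0 := stable_level_gt0 t0.
have [|lt] := ltP x (stable_level t); first by move/(stable_tail_lt x0); rewrite leNgt => ->.
move: lt; rewrite le_eqVlt => /predU1P[<-|/(stable_tail_lt l0)/ltW ->//].
by rewrite lexx.
Qed.

Lemma stable_tail_cvg0 : stable_tail x @[x --> +oo] --> 0.
Proof.
apply/cvgrPdist_le => e e0; near=> x.
have x0 : 0 < x by near: x; exact: nbhs_pinfty_gt.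
rewrite sub0r normrN ger0_norm ?(ltW (stable_tail_gt0 x0))//.
by rewrite -stable_level_le//; near: x; exact: nbhs_pinfty_ge.
Unshelve. all: by end_near. Qed.

Lemma is_derive_stable_tail (x : R) : 0 < x ->
  is_derive x 1 (fun x => - stable_tail x) (stable_density alpha C x).
Proof.
move=> x0; have dx := is_derive1_powR (- alpha) x0.
have := is_deriveN (is_deriveZ C dx).
rewrite /stable_tail /stable_density /GRing.scale/=.
by move=> h; apply: (@is_derive_eq _ _ _ _ _ _ _ _ h); ring.
Qed.

Lemma continuous_stable_density (x : R) : 0 < x ->
  {for x, continuous (stable_density alpha C)}.
Proof.
move=> x0; apply: cvgMr.
exact: (is_derive_continuous (is_derive1_powR _ x0)).
Qed.

Lemma stable_density_ge0 x : 0 <= stable_density alpha C x.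
Proof. by rewrite mulr_ge0 ?powR_ge0// mulr_ge0 ?ltW. Qed.

Lemma measurable_stable_density : measurable_fun setT (stable_density alpha C).
Proof. by apply: measurable_funM => //; exact: measurable_powR. Qed.

Lemma integral_stable_ray a : 0 < a ->
  (\int[@lebesgue_measure R]_(x in `[a, +oo[) (stable_density alpha C x)%:E =
   (stable_tail a)%:E)%E.
Proof.
move=> a0; rewrite (@ge0_continuous_FTC2y _ _ (fun x => - stable_tail x) a 0).
- by rewrite -EFinB opprK add0r.
- by move=> x _; exact: stable_density_ge0.
- apply: continuous_in_subspaceT => x; rewrite inE/= in_itv/= andbT => ax.
  by apply: continuous_stable_density; exact: lt_le_trans ax.
- by rewrite -oppr0; apply: cvgN; exact: stable_tail_cvg0.
- move=> x ax; have := is_derive_stable_tail (lt_trans a0 ax).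
  by move=> h; exact: ex_derive.
- by apply: cvg_at_right_filter; exact: (is_derive_continuous (is_derive_stable_tail a0)).
- move=> x; rewrite in_itv/= andbT => ax; rewrite derive1E.
  by have h := is_derive_stable_tail (lt_trans a0 ax); exact: derive_val.
Qed.

Lemma integral_stable_itv a b : 0 < a -> a <= b ->
  (\int[@lebesgue_measure R]_(x in `[a, b[) (stable_density alpha C x)%:E =
   (stable_tail a - stable_tail b)%:E)%E.
Proof.
move=> a0 ab; have b0 := lt_le_trans a0 ab.
have abU : `[a, +oo[%classic = `[a, b[%classic `|` `[b, +oo[%classic.
  by rewrite -(@itv_bndbnd_setU _ _ _ (BLeft b))// bnd_simp.
have := integral_stable_ray a0; rewrite abU ge0_integral_setU//.
- rewrite integral_stable_ray//.
  move/(congr1 (fun z => z - (stable_tail b)%:E)%E); rewrite addeK// -EFinB//.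
- apply/measurable_EFinP; apply: measurable_funTS; exact: measurable_stable_density.
- by move=> x _; rewrite lee_fin stable_density_ge0.
- apply/disj_setPS => x [/=]; rewrite !in_itv/= andbT => /andP[_ xb].
  by rewrite leNgt xb.
Qed.

(** Time is integrated out over an interval of length 1, which leaves the density alone. *)
Lemma time_size_intensity_unit_time (B : set R) : measurable B ->
  B `<=` `]0%R, +oo[%classic ->
  (time_size_intensity (stable_density alpha C) (`[0%R, 1%R]%classic `*` B) =
  \int[@lebesgue_measure R]_(x in B) (stable_density alpha C x)%:E)%E.
Proof.
move=> mB B0; rewrite /time_size_intensity.
pose f (z : R * R) := (stable_density alpha C z.2 * (\1_(`]0%R, 1%R]%classic : set R) z.1 * \1_B z.2))%:E.
have f0 z : (0 <= f z)%E by rewrite lee_fin mulr_ge0 ?stable_density_ge0 ?mulr_ge0.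
have mf : measurable_fun setT f.
  apply/measurable_EFinP; apply: measurable_funM.
    exact: (measurableT_comp measurable_stable_density measurable_snd).
  apply: measurable_funM.
    exact: (measurableT_comp (measurable_indic _) measurable_fst).
  exact: (measurableT_comp (measurable_indic _) measurable_snd).
transitivity (\int[(@lebesgue_measure R) \x (@lebesgue_measure R)]_z f z)%E.
  rewrite integral_mkcond; apply: eq_integral => -[t x] _.
  rewrite /f /patch/= !indicE.
  case: ifPn => [|/negP]; rewrite !inE /= !in_itv/= !andbT.
    move=> [[/andP[_ t1] Bx] [t0 x0]].
    by rewrite !mem_set ?mulr1//= in_itv/= t0.
  move=> H; have [t01|t01] := pselect (`]0%R, 1%R]%classic t); last by rewrite memNset// mul0r mulr0.
  have [Bx|Bx] := pselect (B x); last by rewrite [x \in B]memNset// !mulr0.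
  exfalso; apply: H; move: t01; rewrite /= in_itv/= => /andP[t0 t1].
  split; split => //; first by rewrite (ltW t0).
  by have := B0 _ Bx; rewrite /= in_itv/= andbT.
rewrite fubini_tonelli2// [RHS]integral_mkcond; apply: eq_integral => x _.
rewrite /fubini_G /f/=.
under eq_integral do rewrite mulrCA EFinM.
rewrite ge0_integralZr//; first last.
- by rewrite lee_fin mulr_ge0 ?stable_density_ge0.
- by apply/measurable_EFinP; exact: measurable_indic.
rewrite integral_indic// setIT /= lebesgue_measure_itv/= lte01 sube0 mul1e.
rewrite /patch indicE; have [Bx|Bx] := pselect (B x).
  by rewrite mem_set// mulr1.
by rewrite memNset// mulr0.
Qed.

End stable_intensity.

Lemma measurable_fun_nat_ereal {R : realType} {d : measure_display} {T : measurableType d}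
    (X : T -> nat) : measurable_fun setT (fun w => (X w)%:R%:E : \bar R) ->
  measurable_fun setT X.
Proof.
move=> mX _ B _; rewrite setTI.
rewrite (_ : _ @^-1` B = \bigcup_(k in B) [set w | (X w)%:R%:E = k%:R%:E :> \bar R]).
  apply: bigcup_measurable => k _; rewrite -[X in measurable X]setTI.
  exact: (mX measurableT [set k%:R%:E] (emeasurable_set1 _)).
apply/seteqP; split => w /=; first by move=> Bw; exists (X w).
by move=> [k Bk /= [/eqP]]; rewrite eqr_nat => /eqP ->.
Qed.

Section stable_jump_process.
Context {R : realType} {d : measure_display} {Omega : measurableType d}.
Variables (P : probability Omega R) (S : R -> Omega -> R) (alpha C : R).
Hypotheses (alpha0 : 0 < alpha) (C0 : 0 < C).
Hypothesis hS : driftless_subordinator P S (stable_density alpha C).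

Let level := stable_level alpha C.
Let tail := stable_tail alpha C.
Let D : set R := [set s | 0 < s /\ s <= 1].

Definition unit_time_count (w : Omega) (x : R) : nat := jumps_count D (jump S w) x.

Lemma esum_jumps w : (S 1 w)%:E = (\esum_(s in D) (jump S w s)%:E)%E.
Proof. by have [_ _ /(_ w 1 ler01)] := hS. Qed.

Lemma tail_count_unit_time w : tail_count (unit_time_count w).
Proof. exact: tail_count_jumps (esum_jumps w). Qed.

Lemma jumps_to_1_ray w x : 0 < x ->
  jumps_to_1 S w `[x, +oo[%classic = (unit_time_count w x)%:R%:E.
Proof.
move=> x0; rewrite -(counting_jumps_ge (esum_jumps w) x0).
congr counting; apply/seteqP; split => s /=; rewrite !in_itv/= !andbT.
  by move=> [s0 _ [/andP[_ s1] xs]].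
by move=> [[s0 s1] xs]; split => //; [exact: lt_le_trans xs|rewrite (ltW s0)].
Qed.

Lemma measurable_jumps_to_1 (B : set R) : measurable B ->
  measurable_fun setT (fun w => jumps_to_1 S w B).
Proof.
move=> mB; have [_ [mN _ _] _] := hS; apply: mN.
by apply: measurableX => //; exact: measurable_itv.
Qed.

(** At t = 0 the level should be +oo, whereas the power of 0 would give 0 and hence all sizes; the
    ray is made empty there. *)
Definition level_ray (t : R) : set R :=
  if 0 < t then `[level t, +oo[%classic else set0.

(* In the time scale [t = C x^-alpha] the jumps up to time 1 form a Poisson
   process of unit rate. *)
Definition level_count (w : Omega) (t : R) : nat :=
  if 0 < t then unit_time_count w (level t) else 0%N.

Lemma measurable_level_ray t : measurable (level_ray t).
Proof. by rewrite /level_ray; case: ifP => _ //; exact: measurable_itv. Qed.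

Lemma level_ray_gt0 t : level_ray t `<=` `]0, +oo[%classic.
Proof.
rewrite /level_ray; case: ifPn => [t0 x|_ x []]; rewrite /= !in_itv/= !andbT.
by apply: lt_le_trans; exact: stable_level_gt0.
Qed.

Lemma level_anti s t : 0 < s -> s <= t -> level t <= level s.
Proof.
move=> s0 st; have t0 := lt_le_trans s0 st.
by rewrite stable_level_le// ?stable_level_gt0// stable_levelK.
Qed.

Lemma level_ray_sub s t : s <= t -> level_ray s `<=` level_ray t.
Proof.
move=> st; rewrite /level_ray; case: ifPn => [s0|_ x []]; rewrite (lt_le_trans s0 st).
move=> x; rewrite /= !in_itv/= !andbT; apply: le_trans; exact: level_anti.
Qed.

(** Translates between sets of sizes, where the Poisson property is stated, and increments of
    [level_count]. The rays are nested and contain finitely many jumps, so the cardinal of the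
    difference is the difference of the cardinals. *)
Lemma jumps_between s t w : s <= t ->
  jumps_to_1 S w (level_ray t `\` level_ray s) =
  (level_count w t - level_count w s)%N%:R%:E.
Proof.
move=> st.
pose J u := [set x | D x /\ level_ray u (jump S w x)].
have JE u : 0 < u -> J u = jumps_ge D (jump S w) (level u).
  move=> u0; rewrite /J /level_ray u0; apply/seteqP.
  by split => x /=; rewrite in_itv/= andbT.
have JE0 u : ~~ (0 < u) -> J u = set0.
  by move=> /negbTE u0; rewrite /J /level_ray u0; apply/seteqP; split => // x [].
have Jfin u : finite_set (J u).
  have [u0|u0] := boolP (0 < u); last by rewrite JE0.
  by rewrite JE//; apply: (finite_jumps_ge (esum_jumps w)); exact: stable_level_gt0.
have cJ u : #|` fset_set (J u)|%fset = level_count w u.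
  rewrite /level_count; have [u0|u0] := boolP (0 < u); last by rewrite JE0// fset_set0 cardfs0.
  by rewrite JE.
have -> : jumps_to_1 S w (level_ray t `\` level_ray s) = counting (J t `\` J s).
  congr counting; apply/seteqP; split => x /=; rewrite in_itv/=.
    by move=> [x0 _ [/andP[_ x1] [Lt Ls]]]; split => // -[_ /Ls].
  move=> [[[x0 x1] Lt] H]; split => //.
    by have := level_ray_gt0 Lt; rewrite /= in_itv/= andbT.
  by split; [rewrite (ltW x0)|split => // Ls; apply: H].
rewrite /counting asboolT; last exact: finite_setD.
have Jsub : (fset_set (J s) `<=` fset_set (J t))%fset.
  rewrite -(fset_set_sub (Jfin s) (Jfin t)).
  by move=> x [Dx Ls]; split; [exact: Dx|exact: level_ray_sub st _ Ls].
rewrite -(cJ t) -(cJ s) -(cardfsDS Jsub).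
by rewrite (fset_setD (Jfin t) (Jfin s)).
Qed.

(** The level is the inverse of the tail mass, so the intensity becomes length: this is where the
    unit rate comes from. *)
Lemma time_size_intensity_between s t : 0 <= s -> s <= t ->
  time_size_intensity (stable_density alpha C)
    (`[0%R, 1%R]%classic `*` (level_ray t `\` level_ray s)) = (t - s)%:E.
Proof.
move=> s0 st; rewrite time_size_intensity_unit_time//; first last.
- by move=> x [/level_ray_gt0].
- by apply: measurableD; exact: measurable_level_ray.
rewrite /level_ray; have [t0|] := ltP 0 t; last first.
  move=> t0; have -> : t = s by apply/eqP; rewrite eq_le st (le_trans t0).
  by rewrite set0D integral_set0 subrr.
have [s0'|s0'] := ltP 0 s; last first.
  have -> : s = 0 by apply/eqP; rewrite eq_le s0 s0'.
  by rewrite setD0 integral_stable_ray ?stable_level_gt0// stable_levelK// subr0.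
have -> : `[level t, +oo[%classic `\` `[level s, +oo[%classic = `[level t, level s[%classic.
  apply/seteqP; split => x /=; rewrite !in_itv/= !andbT.
    by move=> [-> /negP]; rewrite -ltNge => ->.
  by move=> /andP[-> xs]; split => //; apply/negP; rewrite -ltNge.
rewrite integral_stable_itv// ?stable_level_gt0// ?level_anti//.
by rewrite !stable_levelK.
Qed.

(** Time runs against size: left continuity of the counts in the size becomes right continuity in t,
    and increments over successive intervals are counts in disjoint sets of sizes. *)
Lemma unit_poisson_process_level_count : unit_poisson_process P level_count.
Proof.
have [_ [mN PN iN] _] := hS.
have mA (s t : R) : measurable (`[0%R, 1%R]%classic `*` (level_ray t `\` level_ray s) : set (R * R)).
  by apply: measurableX; [exact: measurable_itv|apply: measurableD; exact: measurable_level_ray].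
have Kmono w s t : 0 <= s -> s <= t -> (level_count w s <= level_count w t)%N.
  move=> s0 st; rewrite /level_count; have [s0'|] := boolP (0 < s); last by [].
  rewrite (lt_le_trans s0' st); have [+ _ _] := tail_count_unit_time w; apply.
    by rewrite stable_level_gt0// (lt_le_trans s0' st).
  exact: level_anti.
split.
- move=> w; have [mono left [b b0 kb]] := tail_count_unit_time w; split.
  + by rewrite /level_count ltxx.
  + exact: Kmono.
  + move=> t; rewrite le_eqVlt => /predU1P[<-|t0].
      (* No jump reaches b, and up to time [tail b] the levels are at least b. *)
      exists (tail b); first exact: stable_tail_gt0.
      move=> s s0; rewrite add0r => sb; rewrite /level_count ltxx; case: ifPn => // s0'.
      apply/eqP; rewrite -leqn0 -kb; apply: mono => //.
      by rewrite leNgt; apply/negP => /(stable_tail_lt alpha0 C0 (stable_level_gt0 _ C0 s0')); rewrite stable_levelK// ltNge sb.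
    have l0 : 0 < level t by exact: stable_level_gt0.
    have [e e0 [el He]] := left _ l0.
    have le0 : 0 < level t - e by rewrite subr_gt0.
    (* [tail (level t - e)] is the time whose level is [level t - e], the end of the range on which
       the count is constant. *)
    exists (tail (level t - e) - t).
      rewrite subr_gt0 -[X in X < _](stable_levelK alpha0 C0 t0).
      by apply: stable_tail_lt => //; rewrite gtrDl oppr_lt0.
    move=> s ts; rewrite addrC subrK => st; have s0 := lt_le_trans t0 ts.
    rewrite /level_count t0 s0; apply: He; last exact: level_anti.
    rewrite -[X in X <= _](stable_tailK alpha0 C0 le0).
    exact: level_anti.
- move=> t t0; apply: (@measurable_fun_nat_ereal R).
  have -> : (fun w => (level_count w t)%:R%:E) = (fun w => jumps_to_1 S w (level_ray t `\` level_ray 0)).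
    by apply/funext => w; rewrite jumps_between// [X in (_ - X)%N]/level_count ltxx subn0.
  by apply: measurable_jumps_to_1; apply: measurableD; exact: measurable_level_ray.
- move=> n t t0 tS B.
  have tmono i j : (i <= j)%N -> t i <= t j.
    by move=> ij; rewrite -(subnKC ij); elim: (j - i)%N => [|k IH]; rewrite ?addn0// addnS (le_trans IH).
  pose A (i : 'I_n) : set (R * R) := `[0%R, 1%R]%classic `*` (level_ray (t i.+1) `\` level_ray (t i)).
  have tA : trivIset setT A.
    apply/trivIsetP => i j _ _; wlog ij : i j / (i < j)%N => [H|_].
      rewrite neq_ltn => /orP[ij|ji]; first by apply: H => //; rewrite -val_eqE/= ltn_eqF.
      by rewrite setIC; apply: H => //; rewrite -val_eqE/= ltn_eqF.
    apply/seteqP; split => // x [[_ [Li _]] [_ [_ Lj]]]; apply: Lj.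
    by apply: level_ray_sub Li; exact: tmono.
  pose B' (i : 'I_n) : set (\bar R) := [set k%:R%:E | k in B i].
  have mB' i : measurable (B' i).
    rewrite (_ : B' i = \bigcup_(k in B i) [set k%:R%:E]).
      by apply: bigcup_measurable => k _; exact: emeasurable_set1.
    by apply/seteqP; split => x [k Bk]; [move=> <-; exists k|move=> ->; exists k].
  have pre (i : 'I_n) : (fun w => jump_measure S w (A i)) @^-1` B' i =
      [set w | B i (level_count w (t i.+1) - level_count w (t i))%N].
    apply/seteqP; split => w; rewrite /= -/(jumps_to_1 S w _) jumps_between//.
      by move=> [k Bk [/eqP]]; rewrite eqr_nat => /eqP <-.
    by move=> Bk; exists (level_count w (t i.+1) - level_count w (t i))%N.
  have := iN n A (fun i => mA _ _) tA B' mB'.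
  rewrite big_mkord; under [RHS]eq_bigr do rewrite pre.
  move=> <-; congr (P _); apply/seteqP; split => w /=.
    move=> H i _; rewrite pre; exact: H.
  move=> H i ni.
  have : [set w | B i (level_count w (t i.+1) - level_count w (t i))%N] w.
    by rewrite -(pre (Ordinal ni)); exact: H.
  by [].
- move=> s t s0 st k.
  have := PN _ (mA s t); rewrite time_size_intensity_between// => /(_ k).
  have -> : [set w | jump_measure S w (`[0%R, 1%R]%classic `*` (level_ray t `\` level_ray s)) = k%:R%:E] =
     [set w | (level_count w t - level_count w s)%N = k].
    apply/seteqP; split => w; rewrite /= -/(jumps_to_1 S w _) jumps_between//.
      by move=> [/eqP]; rewrite eqr_nat => /eqP.
    by move=> ->.
  (* When s = t the parameter is 0 and [poisson_prob] is the Dirac mass at 0. *)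
  move=> ->; rewrite /poisson_prob; case: ifPn => [l0|].
    rewrite esum_set1; first by rewrite /poisson_pmf l0.
    by rewrite lee_fin poisson_pmf_ge0.
  rewrite -leNgt => l0; have -> : t - s = 0 by apply/eqP; rewrite eq_le l0 subr_ge0.
  rewrite /dirac indicE oppr0 expR0 mulr1; case: k => [|k].
    by rewrite expr0 fact0 divr1 mem_set.
  by rewrite expr0n/= mul0r memNset.
Qed.

End stable_jump_process.

(** * Negative binomial processes *)

Section almost_sure.
Context {R : realType} {d : measure_display} {T : measurableType d}.
Variable P : probability T R.

Lemma probability_eq_on (A B G : set T) : measurable A -> measurable B ->
  measurable G -> P G = 1%E -> A `&` G = B `&` G -> P A = P B.
Proof.
move=> mA mB mG PG AB.
have PNG : P (~` G) = 0%E by rewrite probability_setC// PG subee.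
have cut X : measurable X -> P X = P (X `&` G).
  move=> mX; rewrite -[in LHS](setIT X) -(setUv G) setIUr measureU//; last 3 first.
  - exact: measurableI.
  - by apply: measurableI => //; exact: measurableC.
  - by rewrite setIACA setICr setI0.
  rewrite [X in (_ + X)%E](_ : _ = 0%E) ?adde0//.
  apply/eqP; rewrite eq_le measure_ge0 andbT -[leRHS]PNG; apply: le_measure; rewrite ?inE//.
  - by apply: measurableI => //; exact: measurableC.
  - exact: measurableC.
by rewrite cut// AB -cut.
Qed.

(** Serves both configurations. On [H] the ray counts are finite; off [H] the rank has its default
    value 0, below every level x > 0. *)
Lemma measurable_ranked_point (N : T -> set R -> \bar R) (k : T -> R -> nat)
    (H : set T) i :
  measurable H -> (forall w, H w -> tail_count (k w)) ->
  (forall w, H w -> forall x, 0 < x -> N w `[x, +oo[%classic = (k w x)%:R%:E) ->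
  (forall w, ~ H w -> ranked_point (N w) i = 0) ->
  (forall x, 0 < x -> measurable_fun setT (fun w => N w `[x, +oo[%classic)) ->
  measurable_fun setT (fun w => ranked_point (N w) i).
Proof.
move=> mH Hk HN H0 mN.
apply: (measurability (@RGenCInfty.G R)); first exact: RGenCInfty.measurableE.
move=> _ [_ [x ->] <-]; rewrite setTI.
have [x0|x0] := leP x 0.
  rewrite (_ : _ @^-1` _ = setT)//; apply/seteqP; split => // w _ /=.
  by rewrite in_itv/= andbT (le_trans x0)// ranked_point_ge0.
rewrite (_ : _ @^-1` _ = H `&` [set w | (i.+1%:R%:E <= N w `[x, +oo[%classic)%E]).
  apply: measurableI => //; rewrite -[X in measurable X]setTI.
  by apply: emeasurable_fun_c_infty => //; exact: mN.
apply/seteqP; split => w /=; rewrite in_itv/= andbT.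
  have [Hw|Hw] := pselect (H w); last by rewrite H0// leNgt x0.
  by rewrite (ranked_point_ge i (Hk w Hw) (HN w Hw) x0) HN// lee_fin ler_nat.
by move=> [Hw]; rewrite (ranked_point_ge i (Hk w Hw) (HN w Hw) x0) HN// lee_fin ler_nat.
Qed.

End almost_sure.

(** Continuity from above at the empty set gives a value below 1, and a natural number below 1 is
    0. *)
Lemma measure_nat_vanish (R : realType) (mu : {measure set R -> \bar R})
    (F : (set R)^nat) :
  (forall A, measurable A -> mu A = +oo%E \/ exists k : nat, mu A = k%:R%:E) ->
  (forall i, measurable (F i)) -> \bigcap_n F n = set0 ->
  {homo F : n m / (n <= m)%N >-> (m <= n)%O} -> (mu (F 0%N) < +oo)%E ->
  exists n, mu (F n) = 0%E.
Proof.
move=> munat mF capF homoF F0.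
have := @nonincreasing_cvg_mu _ _ _ mu F F0 mF _ homoF.
rewrite capF measure0 => /(_ measurable0) cvg0.
have : \forall n \near \oo, (mu (F n) < 1)%E.
  apply: (cvg0 [set y : \bar R | (y < 1)%E]).
  by apply: open_nbhs_nbhs; split; [exact: open_ereal_lt_ereal|exact: lte01].
move=> [n _ /(_ n (leqnn n)) Fn]; exists n.
case: (munat _ (mF n)) => [E|[k E]]; first by move: Fn; rewrite E.
move: Fn; rewrite E lte_fin.
by case: k {E} => // k; rewrite ltNge ler1n.
Qed.

Section negative_binomial_configuration.
Context {R : realType} {d : measure_display} {Omega : measurableType d}.
Variables (P : probability Omega R) (alpha : R) (r : nat).
Variable N : Omega -> {measure set R -> \bar R}.
Hypothesis alpha0 : 0 < alpha.
Hypothesis hN : negative_binomial_process P r%:R (truncated_stable_density alpha) N.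

Definition window_count (w : Omega) (a b : R) : nat := Num.truncn (fine (N w `[a, b[%classic)).

Definition ray_count (w : Omega) (a : R) : nat := Num.truncn (fine (N w `[a, +oo[%classic)).

Let Nnat w A : measurable A -> N w A = +oo%E \/ exists k : nat, N w A = k%:R%:E.
Proof. by have [[_ + _ _] _] := hN; apply. Qed.

Let mN A : measurable A -> measurable_fun setT (fun w => N w A).
Proof. by have [[+ _ _ _] _] := hN; apply. Qed.

Let Nfin w A : measurable A -> (N w A < +oo)%E ->
  N w A = (Num.truncn (fine (N w A)))%:R%:E.
Proof.
by move=> mA; have [->//|[k ->]] := Nnat w mA; rewrite /= natrK.
Qed.

Lemma window_countE w (a b : R) : 0 < a ->
  N w `[a, b[%classic = (window_count w a b)%:R%:E.
Proof.
move=> a0; apply: Nfin; first exact: measurable_itv.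
have [[_ _ _ Nb] _] := hN; apply: (le_lt_trans _ (Nb w a b a0)).
apply: le_measure; rewrite ?inE; [exact: measurable_itv|exact: measurable_itv|].
by apply: subset_itvl; rewrite bnd_simp.
Qed.

Lemma measurable_window_count (a b : R) : 0 < a ->
  measurable_fun setT (fun w => window_count w a b).
Proof.
move=> a0; apply: (@measurable_fun_nat_ereal R).
by under eq_fun do rewrite -window_countE//; apply: mN; exact: measurable_itv.
Qed.

Lemma window_countD w (a b c : R) : 0 < a -> a <= b -> b <= c ->
  window_count w a c = (window_count w a b + window_count w b c)%N.
Proof.
move=> a0 ab bc; have b0 := lt_le_trans a0 ab.
have U : `[a, c[%classic = `[a, b[%classic `|` `[b, c[%classic.
  by rewrite -(@itv_bndbnd_setU _ _ _ (BLeft b))// bnd_simp.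
suff : ((window_count w a c)%:R%:E = (window_count w a b)%:R%:E + (window_count w b c)%:R%:E :> \bar R)%E.
  by rewrite -EFinD => -[/eqP]; rewrite -natrD eqr_nat => /eqP.
rewrite -(window_countE w c a0) -(window_countE w b a0) -(window_countE w c b0) U.
apply: measureU; [exact: measurable_itv|exact: measurable_itv|].
apply/seteqP; split => // x [/=]; rewrite !in_itv/= => /andP[_ xb] /andP[bx _].
by move: xb; rewrite ltNge bx.
Qed.

(** Test function for the Laplace functional: the value -ln z_i on the i-th window turns exp(-N(f))
    into the product of the powers of the z_i. *)
Let fstep n (x z : nat -> R) (y : R) : R :=
  \sum_(0 <= i < n) (- ln (z i)) * \1_(`[x i.+1, x i[%classic : set R) y.

Lemma integral_indic_ray (g : R -> R) (A : set R) :
  A `<=` `]0, +oo[%classic ->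
  (\int[@lebesgue_measure R]_(y in `]0%R, +oo[) (\1_A y * g y)%:E =
   \int[@lebesgue_measure R]_(y in A) (g y)%:E)%E.
Proof.
move=> A0; rewrite integral_mkcond [RHS]integral_mkcond; apply: eq_integral => y _.
rewrite /patch indicE; have [Ay|Ay] := pselect (A y).
  by rewrite !mem_set//= ?mul1r//; exact: A0.
by rewrite [y \in A]memNset// mul0r; case: ifP.
Qed.

(** The windows are disjoint, so 1 - exp(-f) is the sum of the indicators weighted by 1 - z_i. They
    lie in ]0, 1[, since x_0 <= 1 and they are open on the right, and there the truncated density is
    the stable density with C = 1. *)
Lemma window_generating_function n (x z : nat -> R) :
  x 0%N <= 1 -> (forall i, 0 < x i) -> (forall i, x i.+1 <= x i) ->
  (forall i, 0 < z i <= 1) ->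
  (\int[P]_w (\prod_(0 <= i < n) z i ^+ window_count w (x i.+1) (x i))%:E =
  ((1 + \sum_(0 <= i < n) (1 - z i) * (stable_tail alpha 1 (x i.+1) - stable_tail alpha 1 (x i)))^-1 ^+ r)%:E)%E.
Proof.
move=> x01 x0 xS z01.
have xanti i j : (i <= j)%N -> x j <= x i.
  by move=> ij; rewrite -(subnKC ij); elim: (j - i)%N => [|k IH]; rewrite ?addn0// addnS (le_trans _ IH).
have lz i : 0 <= - ln (z i) by have /andP[? ?] := z01 i; rewrite oppr_ge0 ln_le0.
have mf : measurable_fun setT (fstep n x z).
  rewrite /fstep; under eq_fun do rewrite big_mkord; apply: measurable_sum => i.
  by apply: measurable_funM => //; exact: measurable_indic.
have [_ /(_ (fstep n x z))] := hN.
move=> /(_ (measurable_funTS mf)) H.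
have {}H := H (fun y _ => sumr_ge0 _ (fun i _ => mulr_ge0 (lz i) (ler0n _ _))).
have A0 i : `[x i.+1, x i[%classic `<=` (`]0%R, +oo[%classic : set R).
  by move=> y /=; rewrite !in_itv/= andbT => /andP[+ _]; exact: lt_le_trans.
transitivity (\int[P]_w expeR (- \int[N w]_(y in `]0%R, +oo[) (fstep n x z y)%:E))%E.
  apply: eq_integral => w _.
  have -> : (\int[N w]_(y in `]0%R, +oo[) (fstep n x z y)%:E =
     (\sum_(0 <= i < n) (- ln (z i)) * (window_count w (x i.+1) (x i))%:R)%:E)%E.
    rewrite /fstep; under eq_integral do rewrite -sumEFin.
    rewrite ge0_integral_sum//; first last.
    - by move=> i y _; rewrite lee_fin mulr_ge0.
    - by move=> i; apply/measurable_EFinP; apply: measurable_funM => //; exact: measurable_indic.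
    rewrite -sumEFin; apply: eq_bigr => i _.
    under eq_integral do rewrite EFinM.
    rewrite ge0_integralZl_EFin//; last by apply/measurable_EFinP; exact: measurable_indic.
    rewrite integral_indic//.
    by rewrite setIidl// window_countE// EFinM.
  rewrite -EFinN /= -sumrN expR_sum; congr _%:E; apply: eq_bigr => i _.
  have /andP[zi0 _] := z01 i.
  by rewrite mulNr opprK expRM_natr lnK.
rewrite H.
have -> : (\int[lebesgue_measure]_(y in `]0%R, +oo[)
     ((1 - expR (- fstep n x z y)) * truncated_stable_density alpha y)%:E =
   (\sum_(0 <= i < n) (1 - z i) * (stable_tail alpha 1 (x i.+1) - stable_tail alpha 1 (x i)))%:E)%E.
  transitivity (\int[@lebesgue_measure R]_(y in `]0%R, +oo[)
     (\sum_(0 <= i < n) ((1 - z i)%:E * (\1_(`[x i.+1, x i[%classic : set R) y * stable_density alpha 1 y)%:E)))%E.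
    apply: eq_integral => y; rewrite inE/= in_itv/= andbT => y0.
    under [RHS]eq_bigr do rewrite -EFinM; rewrite sumEFin; congr _%:E.
    rewrite /fstep !big_mkord.
    have [[i yi]|none] := pselect (exists i : 'I_n, `[x i.+1, x i[%classic y).
      have other (j : 'I_n) : j != i -> \1_(`[x j.+1, x j[%classic : set R) y = 0 :> R.
        move=> ji; rewrite indicE memNset//= in_itv/= => /andP[y1 y2].
        move: yi; rewrite /= in_itv/= => /andP[y3 y4].
        move: ji; rewrite -val_eqE/= neq_ltn => /orP[] /xanti h.
          by move: (lt_le_trans y4 h); rewrite ltNge y1.
        by move: (lt_le_trans y2 h); rewrite ltNge y3.
      rewrite (bigD1 i)//= big1 ?addr0; last by move=> j /other ->; rewrite mulr0.
      rewrite [RHS](bigD1 i)//= big1 ?addr0; last by move=> j /other ->; rewrite mul0r mulr0.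
      have /andP[zi0 _] := z01 i.
      rewrite indicE mem_set// mulr1 mul1r opprK lnK// /truncated_stable_density /stable_density mul1r.
      congr (_ * _); rewrite indicE mem_set ?mulr1//= in_itv/= y0/=.
      move: yi; rewrite /= in_itv/= => /andP[_ /lt_le_trans]; apply.
      by apply: le_trans x01; exact: xanti.
    have zero i : \1_(`[x (i : 'I_n).+1, x i[%classic : set R) y = 0 :> R.
      by rewrite indicE memNset// => yi; apply: none; exists i.
    rewrite big1; last by move=> i _; rewrite zero mulr0.
    by rewrite oppr0 expR0 subrr mul0r big1// => i _; rewrite zero mul0r mulr0.
  have z1 i : 0 <= 1 - z i by have /andP[_] := z01 i; rewrite subr_ge0.
  have mI i : measurable_fun setT (fun y => \1_(`[x i.+1, x i[%classic : set R) y * stable_density alpha 1 y)%R.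
    by apply: measurable_funM; [exact: measurable_indic|exact: measurable_stable_density].
  have I0 i y : 0 <= (\1_(`[x i.+1, x i[%classic : set R) y * stable_density alpha 1 y)%R.
    by rewrite mulr_ge0// stable_density_ge0.
  rewrite ge0_integral_sum//; first last.
  - by move=> i y _; rewrite -EFinM lee_fin mulr_ge0.
  - by move=> i; apply: measurable_funeM; apply/measurable_EFinP; apply: measurable_funTS (mI i).
  rewrite -sumEFin; apply: eq_bigr => i _.
  rewrite ge0_integralZl_EFin//; first last.
  - by apply/measurable_EFinP; exact: measurable_funTS (mI i).
  - by move=> y _; rewrite lee_fin.
  by rewrite integral_indic_ray// integral_stable_itv// EFinM.
set lam := \sum_(0 <= i < n) _.
have lam0 : 0 <= lam.
  apply: sumr_ge0 => i _; rewrite mulr_ge0//; first by have /andP[_] := z01 i; rewrite subr_ge0.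
  rewrite subr_ge0; have := xS i; rewrite le_eqVlt => /predU1P[->//|h].
  by apply/ltW/stable_tail_lt.
have l1 : 0 < 1 + lam by rewrite ltr_wpDr.
rewrite -EFinD /= powR_mulrn ?(ltW l1)// /inve.
by rewrite gt_eqF ?exprn_gt0// exprVn.
Qed.

(** The density vanishes on [1, +oo[, so the Laplace functional at the indicator of this ray gives E
    exp(-X) = 1 for its count X. As X is integer-valued, exp(-X) <= exp(-1) off X = 0; hence 1 <= q
    + exp(-1) (1 - q) with q = P(X = 0), which forces q = 1. *)
Lemma no_point_ge1 : P [set w | N w `[1%R, +oo[%classic = 0%E] = 1%E.
Proof.
pose f : R -> R := \1_(`[1%R, +oo[%classic : set R).
have mf : measurable_fun setT f by exact: measurable_indic.
have [_ /(_ f (measurable_funTS mf) (fun _ _ => ler0n _ _))] := hN.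
rewrite [X in (1 + X)%E](_ : _ = 0%E); last first.
  apply: integral0_eq => y /=; rewrite in_itv/= andbT => y0.
  rewrite /f /truncated_stable_density !indicE; congr _%:E.
  have [y1|y1] := leP 1 y.
    by rewrite [y \in `]0, 1[%classic]memNset ?mulr0//= in_itv/= y0 ltNge y1.
  by rewrite memNset ?oppr0 ?expR0 ?subrr ?mul0r//= in_itv/= andbT leNgt y1.
rewrite adde0 [X in _ = X](_ : _ = 1%E); last first.
  by rewrite /= powR1 /inve oner_eq0 invr1.
pose X w := N w `[1%R, +oo[%classic.
have mX : measurable_fun setT X by apply: mN; exact: measurable_itv.
have -> : (\int[P]_w expeR (- \int[N w]_(x in `]0%R, +oo[) (f x)%:E) = \int[P]_w expeR (- X w))%E.
  apply: eq_integral => w _; rewrite integral_indic//.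
  rewrite setIidl// => y /=; rewrite !in_itv/= !andbT; exact: lt_le_trans.
have mA : measurable [set w | X w = 0%E].
  by rewrite -[A in measurable A]setTI; exact: (mX measurableT [set 0%E] (emeasurable_set1 _)).
have mE : measurable_fun setT (fun w => expeR (- X w)).
  rewrite (_ : (fun w => _) = fun w => if X w == +oo%E then 0%E else (expR (- fine (X w)))%:E); last first.
    apply/funext => w; rewrite /X; have [->|[k ->]] := Nnat w (measurable_itv `[1%R, +oo[); first by rewrite eqxx.
    by [].
  apply: measurable_fun_ifT => //; first exact: measurable_fun_eqe.
  apply/measurable_EFinP; apply: measurableT_comp => //; apply: measurableT_comp => //.
  exact: measurableT_comp.
rewrite -(setUv [set w | X w = 0%E]) ge0_integral_setU//; first last.
- exact/disj_setPCl.
- by move=> w _; exact: expeR_ge0.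
- by rewrite setUv.
- exact: measurableC.
move=> E1.
set p := P [set w | X w = 0%E].
have pf : p \is a fin_num by rewrite fin_num_measure.
have i1 : (\int[P]_(w in [set w | X w = 0%E]) expeR (- X w) = p)%E.
  rewrite (eq_integral (cst 1%E)) ?integral_cst ?mul1e//.
  by move=> w; rewrite inE/= => ->; rewrite oppe0 expeR0.
have i2 : (\int[P]_(w in ~` [set w | X w = 0%E]) expeR (- X w) <= (expR (-1))%:E * (1 - p))%E.
  rewrite -probability_setC//.
  rewrite -(@integral_cst _ _ _ P); last exact: measurableC.
  apply: ge0_le_integral => //.
  - exact: measurableC.
  - by move=> w _; exact: expeR_ge0.
  - exact: measurable_funTS.
  move=> w; rewrite /X /=; have [->|[k ->]] := Nnat w (measurable_itv `[1%R, +oo[).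
    by rewrite /= lee_fin expR_ge0.
  rewrite /= lee_fin ler_expR lerN2 => X0.
  by case: k X0 => [//|k] _; rewrite ler1n.
move: E1 i2; rewrite i1 -(fineK pf) -EFinB -EFinM.
set q := fine p => E1 i2.
have : (1%:E <= (q + expR (-1) * (1 - q))%:E)%E by rewrite -[X in (X <= _)%E]E1 EFinD leeD2l.
rewrite lee_fin => h.
have e1 : expR (-1 : R) < 1 by rewrite expR_lt1 oppr_lt0 ltr01.
have q1 : q <= 1 by rewrite -lee_fin fineK//; exact: probability_le1.
congr _%:E; nra.
Qed.

(** The definition of a point process gives finiteness on compact intervals only. Exceptional
    configurations may have infinitely many points near +oo, and are set aside here. *)
Definition locally_finite_at_oo : set Omega := [set w | (N w `[1%R, +oo[%classic < +oo)%E].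

Lemma measurable_locally_finite_at_oo : measurable locally_finite_at_oo.
Proof.
rewrite -[X in measurable X]setTI; apply: emeasurable_fun_infty_o => //.
by apply: mN; exact: measurable_itv.
Qed.

Let N_ray_split w (x y : R) : x <= y -> N w `[x, +oo[%classic = (N w `[x, y[%classic + N w `[y, +oo[%classic)%E.
Proof.
move=> xy; rewrite -measureU; [|exact: measurable_itv|exact: measurable_itv|].
  by rewrite -(@itv_bndbnd_setU _ _ (BLeft x) (BLeft y))// bnd_simp.
apply/seteqP; split => // u [/=]; rewrite !in_itv/= andbT => /andP[_ uy] yu.
by move: uy; rewrite ltNge yu.
Qed.

Lemma ray_countE w x : locally_finite_at_oo w -> 0 < x ->
  N w `[x, +oo[%classic = (ray_count w x)%:R%:E.
Proof.
move=> Hw x0; apply: Nfin; first exact: measurable_itv.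
have [x1|/ltW x1] := leP x 1.
  by rewrite (N_ray_split w x1) window_countE// lte_add_pinfty// ltry.
apply: le_lt_trans Hw; apply: le_measure; rewrite ?inE; [exact: measurable_itv|exact: measurable_itv|].
by apply: subset_itvr; rewrite bnd_simp.
Qed.

Lemma tail_count_ray w : locally_finite_at_oo w -> tail_count (ray_count w).
Proof.
move=> Hw; have mono (x y : R) : 0 < x -> x <= y -> (ray_count w y <= ray_count w x)%N.
  move=> x0 xy; have y0 := lt_le_trans x0 xy.
  rewrite -(ler_nat R) -lee_fin -!ray_countE// (N_ray_split w xy).
  by rewrite leeDr.
split => //.
- move=> x x0.
  (* The denominator n + 2 keeps [e n < x], so that the windows [x - e n, x[ stay in the positive
     reals; they shrink to the empty set. *)
  pose e (n : nat) : R := x / n.+2%:R.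
  have e0 n : 0 < e n by rewrite divr_gt0.
  have ex n : e n < x by rewrite ltr_pdivrMr// ltr_pMr// ltr1n.
  have [n Fn] : exists n, N w `[x - e n, x[%classic = 0%E.
    apply: (@measure_nat_vanish _ (N w) (fun n => `[x - e n, x[%classic)) => //.
    - exact: Nnat.
    - apply/seteqP; split => // y /= H.
      have yx : y < x by have := H 0%N I; rewrite /= in_itv/= => /andP[].
      have [n _ /(_ n (leqnn n))] : \forall n \near \oo, n.+1%:R^-1 < (x - y) / x.
        have p0 : 0 < (x - y) / x by rewrite divr_gt0// subr_gt0.
        exact: near_infty_natSinv_lt (PosNum p0).
      rewrite ltr_pdivlMr// mulrC => h.
      have := H n I; rewrite /= in_itv/= => /andP[+ _]; rewrite leNgt => /negP; apply.
      rewrite ltrBrDl -ltrBrDr; apply: le_lt_trans h.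
      by rewrite ler_pM2l// lef_pV2 ?posrE// ler_nat.
    - move=> i j ij; apply/subsetPset; apply: subset_itvr; rewrite bnd_simp.
      by rewrite lerD2l lerN2 ler_pM2l// lef_pV2 ?posrE// ler_nat.
    - by rewrite window_countE ?ltry// subr_gt0.
  exists (e n) => //; split => // y xy yx; have y0 : 0 < y by apply: lt_le_trans xy; rewrite subr_gt0.
  apply/eqP; rewrite -(eqr_nat R) -eqe -!ray_countE// (N_ray_split w yx).
  rewrite [X in (X + _)%E](_ : _ = 0%E) ?add0e//; apply/eqP; rewrite eq_le measure_ge0 andbT -Fn.
  apply: le_measure; rewrite ?inE; [exact: measurable_itv|exact: measurable_itv|].
  by apply: subset_itvr; rewrite bnd_simp.
- have [n Fn] : exists n : nat, N w `[n.+1%:R, +oo[%classic = 0%E.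
    apply: (@measure_nat_vanish _ (N w) (fun n => `[n.+1%:R, +oo[%classic)) => //.
    - exact: Nnat.
    - apply/seteqP; split => // y /= H.
      have := H (Num.truncn y) I; rewrite /= in_itv/= andbT leNgt => /negP; apply.
      exact: truncnS_gt.
    - by move=> i j ij; apply/subsetPset; apply: subset_itvr; rewrite bnd_simp ler_nat.
  by exists n.+1%:R => //; apply/eqP; rewrite -(eqr_nat R) -eqe -ray_countE// Fn.
Qed.

(** Compact windows hold finitely many points, so an infinite count on [1, +oo[ stays infinite on
    every further ray. The set defining the rank is then unbounded and its [sup] is 0 by
    convention. *)
Lemma ranked_point_not_finite w i : ~ locally_finite_at_oo w -> ranked_point (N w) i = 0.
Proof.
move=> Hw; apply: sup_out => -[_ [b ub]].
have Ninf : N w `[1%R, +oo[%classic = +oo%E.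
  by have [//|[k Nk]] := Nnat w (measurable_itv `[1%R, +oo[); case: Hw; rewrite /locally_finite_at_oo /= Nk ltry.
pose y : R := Num.max b 0 + 1.
have y1 : 1 <= y by rewrite lerDr le_max lexx orbT.
have y0 : 0 < y by exact: lt_le_trans y1.
suff yb : y <= b by move: yb; apply/negP; rewrite -ltNge ltr_pwDr// le_max lexx.
apply: ub; split => //.
move: Ninf; rewrite (N_ray_split w y1) window_countE//.
have [->|[k ->]] := Nnat w (measurable_itv `[y, +oo[); first by rewrite leey.
by [].
Qed.

Lemma measurable_ranked_point_nb i : measurable_fun setT (fun w => ranked_point (N w) i).
Proof.
apply: (@measurable_ranked_point _ _ _ _ ray_count locally_finite_at_oo).
- exact: measurable_locally_finite_at_oo.
- exact: tail_count_ray.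
- by move=> w Hw x; exact: ray_countE.
- by move=> w; exact: ranked_point_not_finite.
- by move=> x _; apply: mN; exact: measurable_itv.
Qed.

(** For x >= 1 the window is [1, 1[, which is empty, and both sides are false. *)
Lemma ranked_point_nb_ge w i x : N w `[1%R, +oo[%classic = 0%E -> 0 < x ->
  (x <= ranked_point (N w) i) = (i < window_count w (Num.min x 1%R) 1%R)%N.
Proof.
move=> N1 x0; have Hw : locally_finite_at_oo w by rewrite /locally_finite_at_oo /= N1.
rewrite (ranked_point_ge i (tail_count_ray Hw) (fun x => @ray_countE w x Hw) x0).
congr (i < _)%N; apply/eqP; rewrite -(eqr_nat R) -eqe -ray_countE// -window_countE ?lt_min ?x0 ?ltr01//.
have [x1|/ltW x1] := leP x 1.
  by rewrite (N_ray_split w x1) N1 adde0.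
rewrite set_itvco0 measure0 eq_le measure_ge0 andbT -N1; apply: le_measure; rewrite ?inE; [exact: measurable_itv|exact: measurable_itv|].
by apply: subset_itvr; rewrite bnd_simp.
Qed.

End negative_binomial_configuration.

(** * Comparison of the two laws *)

Section law_from_counts.
Context {R : realType}.

(* [W] enumerates in decreasing order the points of a configuration, of which
   [c w a b] lie in [a, b); the points above 1 are almost surely absent. *)
Definition counted_ranks d (T : measurableType d) (P : probability T R)
    (W : T -> nat -> R) (c : T -> R -> R -> nat) : Prop :=
  [/\ forall i, measurable_fun setT (W ^~ i),
      forall w i, 0 <= W w i,
      forall a b, 0 < a -> a <= b -> b <= 1 -> measurable_fun setT (fun w => c w a b),
      forall w a b e, 0 < a -> a <= b -> b <= e -> e <= 1 ->
        c w a e = (c w a b + c w b e)%N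
    & exists2 G : set T, measurable G /\ P G = 1%E &
        forall w, G w -> forall i x, 0 < x ->
          (x <= W w i) = (i < c w (Num.min x 1%R) 1%R)%N].

(** Window ends: 1, then the entries of [s], then the last of them forever, so that windows past the
    end are empty. *)
Definition count_profile (s : seq R) (i : nat) : R := nth (last 1 s) (1 :: s) i.

Lemma count_profile_anti (s : seq R) i : path >=%O 1 s ->
  count_profile s i.+1 <= count_profile s i.
Proof.
move=> ps; have [si|si] := ltnP i (size s).
  by have /(pathP (last 1 s)) := ps; apply.
rewrite /count_profile /= nth_default//.
move: si; rewrite leq_eqVlt => /predU1P[<-|si]; last by rewrite nth_default.
by rewrite (set_nth_default 1)// -[size s]/((size (1 :: s)).-1) nth_last.
Qed.

Lemma count_profile_gt0 (s : seq R) i : all (fun v => 0 < v) s -> 0 < count_profile s i.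
Proof.
move=> s0; have s1 : all (fun v => 0 < v) (1 :: s) by rewrite /= ltr01.
have [si|si] := ltnP i (size (1 :: s)); first by apply: (allP s1); exact: mem_nth.
by rewrite /count_profile nth_default//; apply: (allP s1); exact: mem_last.
Qed.

Lemma measurable_lower_orthant d (T : measurableType d) (W : T -> nat -> R) l :
  (forall i, measurable_fun setT (W ^~ i)) -> measurable (W @^-1` lower_orthant l).
Proof.
move=> mW; have -> : W @^-1` lower_orthant l = \bigcap_(p in [set` l]) [set w | p.2 <= W w p.1].
  by apply/seteqP; split.
apply: fin_bigcap_measurable => // p _; rewrite -[X in measurable X]setTI.
by apply: measurable_fun_le => //; exact: measurable_cst.
Qed.

(** Constraints with a nonpositive bound hold for all nonnegative ranks and are dropped. Bounds
    above 1 are lowered to 1: the window [1, 1[ is empty and the constraint fails, as it does almost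
    surely. *)
Definition thresholds (l : seq (nat * R)) : seq R :=
  sort >=%O [seq Num.min p.2 1 | p <- l & 0 < p.2].

Lemma mem_thresholds l p : p \in l -> 0 < p.2 -> Num.min p.2 1 \in thresholds l.
Proof.
by move=> pl p0; rewrite mem_sort; apply/mapP; exists p => //; rewrite mem_filter p0.
Qed.

Lemma thresholds_itv l v : v \in thresholds l -> 0 < v <= 1.
Proof.
rewrite mem_sort => /mapP[p]; rewrite mem_filter => /andP[p0 _] ->.
by rewrite lt_min p0 ltr01 ge_min lexx orbT.
Qed.

Lemma thresholds_path l : path >=%O 1 (thresholds l).
Proof.
have := sort_sorted (@ge_total _ R) [seq Num.min p.2 1 | p <- l & 0 < p.2].
rewrite -/(thresholds l); have := @thresholds_itv l.
case: (thresholds l) => //= v s /(_ v (mem_head _ _))/andP[_ v1] ->.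
by rewrite andbT.
Qed.

Definition threshold_profile l := count_profile (thresholds l).

Lemma threshold_profile_anti l i : threshold_profile l i.+1 <= threshold_profile l i.
Proof. exact/count_profile_anti/thresholds_path. Qed.

Lemma threshold_profile_gt0 l i : 0 < threshold_profile l i.
Proof. by apply: count_profile_gt0; apply/allP => v /thresholds_itv/andP[]. Qed.

Lemma threshold_profile_le1 l i : threshold_profile l i <= 1.
Proof. by elim: i => // i; apply: le_trans; exact: threshold_profile_anti. Qed.

(** The partial sum collects the windows from 1 down to the threshold of p, hence the points in
    [min(p.2, 1), 1[. The successor of the index appears because the profile starts at 1, one place
    before the thresholds. *)
Definition orthant_counts (l : seq (nat * R)) : set (seq nat) :=
  [set q | forall p, p \in l -> 0 < p.2 ->
    (p.1 < \sum_(0 <= m < (index (Num.min p.2 1%R) (thresholds l)).+1) nth 0%N q m)%N].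

Lemma lower_orthant_counts d (T : measurableType d) (P : probability T R)
    (W : T -> nat -> R) (c : T -> R -> R -> nat) (l : seq (nat * R)) :
  counted_ranks P W c -> let x := threshold_profile l in
  P (W @^-1` lower_orthant l) =
  P [set w | orthant_counts l (mkseq (fun i => c w (x i.+1) (x i)) (size (thresholds l)))].
Proof.
move=> [mW W0 mc cD [G [mG PG] WG]] x; set s := thresholds l.
have xS i : x i.+1 <= x i by exact: threshold_profile_anti.
have x0 i : 0 < x i by exact: threshold_profile_gt0.
have x1 i : x i <= 1 by exact: threshold_profile_le1.
have tele w j : (j < size s)%N ->
    (\sum_(0 <= m < j.+1) nth 0%N (mkseq (fun i => c w (x i.+1) (x i)) (size s)) m)%N =
    c w (x j.+1) 1.
  elim: j => [|j IH] js.
    by rewrite big_nat1 nth_mkseq.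
  rewrite big_nat_recr//= IH; last exact: ltnW.
  by rewrite nth_mkseq// addnC -cD.
have countE w p : p \in l -> 0 < p.2 ->
    (\sum_(0 <= m < (index (Num.min p.2 1%R) s).+1)
       nth 0%N (mkseq (fun i => c w (x i.+1) (x i)) (size s)) m)%N =
    c w (Num.min p.2 1) 1.
  move=> pl p0; have ps := mem_thresholds pl p0.
  by rewrite tele ?index_mem// /x /threshold_profile /count_profile /= nth_index.
apply: (@probability_eq_on _ _ _ _ _ _ G) => //.
- exact: measurable_lower_orthant.
- rewrite (_ : [set w | _] = \bigcap_(p in [set` l])
      [set w | 0 < p.2 -> (p.1 < c w (Num.min p.2 1%R) 1%R)%N]).
    apply: fin_bigcap_measurable => // p _.
    have [p0|p0] := ltP 0 p.2; last first.
      by rewrite (_ : [set w | _] = setT)//; apply/seteqP; split => w //= _ /lt_le_trans/(_ p0); rewrite ltxx.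
    rewrite (_ : [set w | _] = [set w | (p.1 < c w (Num.min p.2 1%R) 1%R)%N]).
      apply: (measurable_preim_nat [set j | (p.1 < j)%N]); apply: mc => //.
        by rewrite lt_min p0 ltr01.
      by rewrite ge_min lexx orbT.
    by apply/seteqP; split => w; [apply|move=> ? _].
  apply/seteqP; split => w H p pl.
    by move=> p0; rewrite -countE//; exact: H.
  by move=> p0; rewrite countE//; exact: H.
- apply/seteqP; split => w [Lw Gw]; split => // p pl.
  + by move=> p0; rewrite countE// -WG//; exact: Lw.
  + have [p0|p0] := ltP 0 p.2; last exact: le_trans p0 (W0 _ _).
    by rewrite WG// -countE//; exact: Lw.
Qed.

Lemma counted_ranks_law_eq d d' (T : measurableType d) (T' : measurableType d')
    (P : probability T R) (P' : probability T' R)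
    (W : T -> nat -> R) (c : T -> R -> R -> nat)
    (W' : T' -> nat -> R) (c' : T' -> R -> R -> nat) :
  counted_ranks P W c -> counted_ranks P' W' c' ->
  (forall n (x z : nat -> R), x 0%N = 1 -> (forall i, 0 < x i) ->
    (forall i, x i.+1 <= x i) -> (forall i, 0 < z i <= 1) ->
    (\int[P]_w (\prod_(0 <= i < n) z i ^+ c w (x i.+1) (x i))%:E =
     \int[P']_w (\prod_(0 <= i < n) z i ^+ c' w (x i.+1) (x i))%:E)%E) ->
  forall A, seq_measurable A -> P (W @^-1` A) = P' (W' @^-1` A).
Proof.
move=> Wc Wc' gfE; have [mW _ mc _ _] := Wc; have [mW' _ mc' _ _] := Wc'.
apply: law_eq_lower_orthants => // l.
rewrite (lower_orthant_counts l Wc) (lower_orthant_counts l Wc').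
set x := threshold_profile l.
have xS i : x i.+1 <= x i by exact: threshold_profile_anti.
have x0 i : 0 < x i by exact: threshold_profile_gt0.
have x1 i : x i <= 1 by exact: threshold_profile_le1.
apply: (@generating_function_law_eq _ _ _ _ _ P P' (size (thresholds l))
  (fun i w => c w (x i.+1) (x i)) (fun i w => c' w (x i.+1) (x i)) _ _ _
  (orthant_counts l)) => [i _|i _|z z01].
- exact: mc.
- exact: mc'.
- exact: gfE.
Qed.

End law_from_counts.

(** * Jumps relative to the r-th largest *)

Section trimmed_stable_jumps.
Context {R : realType} {d : measure_display} {Omega : measurableType d}.
Variables (P : probability Omega R) (S : R -> Omega -> R) (alpha C : R) (r : nat).
Hypotheses (alpha0 : 0 < alpha) (C0 : 0 < C) (r0 : (0 < r)%N).
Hypothesis hS : driftless_subordinator P S (stable_density alpha C).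

Let tail := stable_tail alpha C.
Let K := level_count S alpha C.
Let ppK : unit_poisson_process P K := unit_poisson_process_level_count alpha0 C0 hS.

Definition ranked_jump (w : Omega) (i : nat) : R := ranked_point (jumps_to_1 S w) i.

Lemma ranked_jump_ge w i x : 0 < x ->
  (x <= ranked_jump w i) = (i < unit_time_count S w x)%N.
Proof.
by move=> x0; apply: ranked_point_ge => //; [exact: (tail_count_unit_time hS w)|exact: (jumps_to_1_ray hS w)].
Qed.

Lemma measurable_ranked_jump i : measurable_fun setT (ranked_jump ^~ i).
Proof.
apply: (@measurable_ranked_point _ _ _ (jumps_to_1 S) (unit_time_count S) setT) => //.
- by move=> w _; exact: (tail_count_unit_time hS w).
- by move=> w _; exact: (jumps_to_1_ray hS w).
- by move=> w; case.
- by move=> x x0; exact: (measurable_jumps_to_1 hS (measurable_itv _)).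
Qed.

Let Delta w := ranked_jump w r.-1.

(* [Gamma] is the r-th point of the unit Poisson process [K]. *)
Let Gamma w := tail (Delta w).

Let Delta_gt0 w : reached K r w -> 0 < Delta w.
Proof.
move=> [n]; rewrite /K /level_count; case: ifPn => [n0|_]; last by rewrite leqNgt r0.
rewrite -{1}(prednK r0) -ranked_jump_ge; first by apply: lt_le_trans; exact: stable_level_gt0.
exact: stable_level_gt0.
Qed.

Let K_tail w x : 0 < x -> K w (tail x) = unit_time_count S w x.
Proof. by move=> x0; rewrite /K /level_count stable_tail_gt0// stable_tailK. Qed.

(** [Gamma w <= t] means that the r-th largest jump is at least the level of t, that is, that at
    least r jumps are; ranks start at 0, whence [r.-1]. *)
Let hGamma w : reached K r w -> forall t, 0 <= t -> (Gamma w <= t) = (r <= K w t)%N.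
Proof.
move=> rw t; have D0 := Delta_gt0 rw; rewrite le_eqVlt => /predU1P[<-|t0].
  by rewrite leNgt stable_tail_gt0// /K /level_count ltxx leqNgt r0.
rewrite -stable_level_le// ranked_jump_ge; last exact: stable_level_gt0.
by rewrite prednK// /K /level_count t0.
Qed.

Let good : set Omega := reached K r `&` [set w | K w (Gamma w) = r].

Let measurable_good : measurable good.
Proof.
have H := measurable_fun_at_Gamma ppK r0 hGamma ltr01.
have E : (fun w => K w (1 * Gamma w)) = (fun w => K w (Gamma w)).
  by apply/funext => w; rewrite mul1r.
rewrite E in H; exact: (H (measurable_reached r ppK) [set r] I).
Qed.

Let good1 : P good = 1%E := Gamma_simple ppK r0 hGamma.

Definition relative_jump (w : Omega) (j : nat) : R := ranked_jump w (r + j) / ranked_jump w r.-1.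

Lemma measurable_relative_jump j : measurable_fun setT (relative_jump ^~ j).
Proof.
apply: measurable_funM; first exact: measurable_ranked_jump.
have -> : (fun w => (ranked_jump w r.-1)^-1) = (fun w => ranked_jump w r.-1 `^ (-1)).
  by apply/funext => w; rewrite powR_inv1//; exact: ranked_point_ge0.
apply: (measurableT_comp (measurable_powR _)); exact: measurable_ranked_jump.
Qed.

Lemma relative_jump_ge0 w j : 0 <= relative_jump w j.
Proof. by rewrite divr_ge0// ranked_point_ge0. Qed.

(** The value 0 off [reached] makes the count measurable on the whole space. *)
Let KP (w : Omega) (y : R) : nat := if w \in reached K r then K w (y * Gamma w) else 0%N.

(** On [reached] and for b <= 1, the number of relative jumps in [a, b[: by scaling, a jump of size
    a [Delta] has time a^-alpha [Gamma], whatever C is. *)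
Definition relative_count (w : Omega) (a b : R) : nat :=
  (KP w (stable_tail alpha 1 a) - KP w (stable_tail alpha 1 b))%N.

Let KP_mono w y y' : 0 < y -> y <= y' -> (KP w y <= KP w y')%N.
Proof.
move=> y0 yy'; rewrite /KP; have [/set_mem rw|_] := boolP (w \in reached K r); last exact: leqnn.
have G0 := Gamma_gt0 ppK r0 hGamma rw.
have [/(_ w)[_ Kmono _] _ _ _] := ppK; apply: Kmono.
  by rewrite mulr_ge0// ltW.
by rewrite ler_pM2r.
Qed.

Let tail1_anti a b : 0 < a -> a <= b -> stable_tail alpha 1 b <= stable_tail alpha 1 a.
Proof. by move=> a0; rewrite le_eqVlt => /predU1P[->//|ab]; apply/ltW/stable_tail_lt. Qed.

Let measurable_KP y : 0 < y -> measurable_fun setT (KP ^~ y).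
Proof.
move=> y0; apply: measurable_fun_if => //.
- apply: (measurable_fun_bool true); rewrite setTI.
  by rewrite preimage_mem_true; exact: (measurable_reached r ppK).
- by rewrite setTI preimage_mem_true; exact: (measurable_fun_at_Gamma ppK r0 hGamma y0).
Qed.

(** Without a tie at rank r, exactly r jumps are at least [Delta], so subtracting K(Gamma) = r from
    the count above x [Delta] removes the trimmed jumps and no other. *)
Lemma relative_jump_ge w j x : good w -> 0 < x ->
  (x <= relative_jump w j) = (j < relative_count w (Num.min x 1%R) 1%R)%N.
Proof.
move=> [rw Kr] x0; have D0 := Delta_gt0 rw.
have [mono _ _] := tail_count_unit_time hS w.
rewrite ler_pdivlMr// ranked_jump_ge ?mulr_gt0//.
rewrite /relative_count /KP mem_set//.
have -> : stable_tail alpha 1 1 * Gamma w = Gamma w by rewrite /stable_tail powR1 !mul1r.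
rewrite [K w (Gamma w)]Kr ltn_subRL.
have [x1|/ltW x1] := leP x 1.
  have -> : stable_tail alpha 1 x * Gamma w = tail (x * Delta w).
    by rewrite /Gamma /tail /stable_tail mul1r powRM ?(ltW x0)// ?(ltW D0)// mulrCA.
  by rewrite (K_tail w (mulr_gt0 x0 D0)).
have -> : stable_tail alpha 1 1 * Gamma w = Gamma w by rewrite /stable_tail powR1 !mul1r.
rewrite [K w (Gamma w)]Kr.
(* Here x >= 1 and the window is empty: a jump of rank r + j of size at least x [Delta] would make
   more than r jumps at least [Delta]. *)
apply/idP/idP => [/leq_trans/(_ (mono _ _ D0 _))|]; last by rewrite ltnNge leq_addr.
rewrite -K_tail// [K w _]Kr; apply.
by rewrite ler_peMl// ltW.
Qed.

Lemma counted_ranks_relative_jump : counted_ranks P relative_jump relative_count.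
Proof.
have t0 a : 0 < a -> 0 < stable_tail alpha 1 a by exact: stable_tail_gt0.
split.
- exact: measurable_relative_jump.
- exact: relative_jump_ge0.
- move=> a b a0 ab _; have b0 := lt_le_trans a0 ab.
  by apply: (measurable_fun_nat2 subn); apply: measurable_KP; exact: t0.
- move=> w a b e a0 ab be _; have b0 := lt_le_trans a0 ab; have e0 := lt_le_trans b0 be.
  have := KP_mono w (t0 _ b0) (tail1_anti a0 ab).
  have := KP_mono w (t0 _ e0) (tail1_anti b0 be).
  by rewrite /relative_count; lia.
- by exists good; [split; [exact: measurable_good|exact: good1]|move=> w gw i x; exact: relative_jump_ge].
Qed.

(** With y_i = x_i^-alpha, the strong Markov property leaves the Laplace transform of [Gamma]. The
    bound x_0 <= 1 places the windows after [Gamma], and the complement of [reached] is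
    negligible. *)
Lemma relative_count_generating_function n (x z : nat -> R) :
  x 0%N <= 1 -> (forall i, 0 < x i) -> (forall i, x i.+1 <= x i) ->
  (forall i, 0 < z i <= 1) ->
  (\int[P]_w (\prod_(0 <= i < n) z i ^+ relative_count w (x i.+1) (x i))%:E =
  ((1 + \sum_(0 <= i < n) (1 - z i) * (stable_tail alpha 1 (x i.+1) - stable_tail alpha 1 (x i)))^-1 ^+ r)%:E)%E.
Proof.
move=> x01 x0 xS z01; have [_ _ mc _ _] := counted_ranks_relative_jump.
have x1 i : x i <= 1 by elim: i => // i; apply: le_trans.
pose y i := stable_tail alpha 1 (x i).
have yS i : y i <= y i.+1 by exact: tail1_anti.
have y1 : 1 <= y 0%N.
  by have := tail1_anti (x0 0%N) x01; rewrite [leLHS]/stable_tail powR1 mul1r.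
have lam0 : 0 <= \sum_(0 <= i < n) (1 - z i) * (y i.+1 - y i).
  by apply: sumr_ge0 => i _; rewrite mulr_ge0 ?subr_ge0//; have /andP[] := z01 i.
rewrite -(laplace_Gamma ppK r0 hGamma lam0) -(strong_markov ppK r0 hGamma n z01 y1 yS).
rewrite (ge0_negligible_integral (N := ~` reached K r))//; first last.
- apply: etrans (probability_setC P (measurable_reached r ppK)) _.
  by rewrite (probability_reached ppK r0) subee.
- by move=> w _; rewrite lee_fin; apply: prodr_ge0 => i _; rewrite exprn_ge0//; have /andP[/ltW] := z01 i.
- apply/measurable_EFinP.
  apply: (measurable_prod_exprn (X := fun i w => relative_count w (x i.+1) (x i))) => i _.
  exact: mc.
- by apply: measurableC; exact: (measurable_reached r ppK).
rewrite setDE setCK setTI; apply: eq_integral => w rw.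
by congr _%:E; apply: eq_bigr => i _; rewrite /relative_count /KP rw.
Qed.

Lemma sum_remaining_jumps w :
  (\sum_(0 <= j <oo) (ranked_jump w (r + j))%:E = (trimmed_sum S r w)%:E)%E.
Proof.
have J0 i : (0 <= (ranked_jump w i)%:E)%E by rewrite lee_fin ranked_point_ge0.
have total : (\sum_(0 <= i <oo) (ranked_jump w i)%:E = (S 1 w)%:E)%E.
  apply: (sum_ranks (esum_jumps hS w)); first by move=> i; exact: ranked_point_ge0.
  by move=> i x x0; exact: ranked_jump_ge.
rewrite /trimmed_sum -[(\sum_(_ < _) _)%R](big_mkord xpredT (ranked_jump w)).
rewrite EFinB -total [in RHS](nneseries_split 0 r)// add0n sumEFin addeAC subee// add0e.
by rewrite -(nneseries_addn r)//; apply: eq_eseriesr => i _; rewrite addnC.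
Qed.

Lemma trimmed_ratios_normalize w : good w -> trimmed_ratios S r w = normalize_seq (relative_jump w).
Proof.
move=> [rw Kr]; have D0 := Delta_gt0 rw.
apply/funext => j; rewrite /normalize_seq /trimmed_ratios.
have -> : (\sum_(0 <= i <oo) `|relative_jump w i|%:E = ((Delta w)^-1 * trimmed_sum S r w)%:E)%E.
  rewrite EFinM -sum_remaining_jumps -nneseriesZl; last by move=> i _; rewrite lee_fin ranked_point_ge0.
  by apply: eq_eseriesr => i _; rewrite ger0_norm ?relative_jump_ge0// -EFinM mulrC.
rewrite /= /relative_jump invfM invrK mulrA -/(ranked_jump w (r + j)) -/(Delta w).
by rewrite divfK// gt_eqF.
Qed.

Lemma law_trimmed_ratios A : seq_measurable A ->
  P (trimmed_ratios S r @^-1` A) = P (relative_jump @^-1` (normalize_seq @^-1` A)).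
Proof.
move=> mA; apply: (@probability_eq_on _ _ _ P _ _ good) => //.
- apply: measurable_preim_seq => // j; apply: measurable_funM; first exact: measurable_ranked_jump.
  (* The inverse is a power of exponent -1, because the trimmed sum is nonnegative as a series of
     ranked jumps. *)
  rewrite (_ : (fun w => _) = (fun w => trimmed_sum S r w `^ (-1))); last first.
    apply/funext => w; rewrite powR_inv1// -lee_fin -(sum_remaining_jumps w).
    by apply: nneseries_ge0 => i _ _; rewrite lee_fin ranked_point_ge0.
  apply: (measurableT_comp (measurable_powR _)); apply: measurable_funB.
    by have [[mS _ _ _ _] _ _] := hS; exact: mS.
  by apply: measurable_sum => i; exact: measurable_ranked_jump.
- apply: measurable_preim_seq; [exact: measurable_relative_jump|exact: seq_measurable_normalize].
- by apply/seteqP; split => w [Aw gw]; split => //; move: Aw; rewrite /preimage /= trimmed_ratios_normalize.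
Qed.

End trimmed_stable_jumps.

(** * Ranked points of the negative binomial process *)

Section normalized_negative_binomial.
Context {R : realType} {d : measure_display} {Omega : measurableType d}.
Variables (P : probability Omega R) (alpha : R) (r : nat).
Variable N : Omega -> {measure set R -> \bar R}.
Hypothesis hN : negative_binomial_process P r%:R (truncated_stable_density alpha) N.

Lemma counted_ranks_ranked_point :
  counted_ranks P (fun w i => ranked_point (N w) i) (window_count N).
Proof.
split.
- exact: (measurable_ranked_point_nb hN).
- by move=> w i; exact: ranked_point_ge0.
- by move=> a b a0 _ _; exact: (measurable_window_count hN b a0).
- by move=> w a b e a0 ab be _; exact: (window_countD hN w a0 ab be).
- exists [set w | N w `[1%R, +oo[%classic = 0%E]; last by move=> w + i x; exact: (ranked_point_nb_ge hN).
  split; last exact: (no_point_ge1 hN).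
  have [[mN _ _ _] _] := hN; rewrite -[X in measurable X]setTI.
  exact: (mN _ (measurable_itv _) measurableT [set 0%E] (emeasurable_set1 _)).
Qed.

Lemma normalized_points_normalize w : normalized_points N w = normalize_seq (ranked_point (N w)).
Proof.
apply/funext => j; rewrite /normalized_points /normalize_seq /total_mass.
by under [in RHS]eq_eseriesr do rewrite ger0_norm ?ranked_point_ge0//.
Qed.

End normalized_negative_binomial.

Theorem mainTheorem5 (R : realType) (alpha C : R) (r : nat)
    (halpha0 : 0 < alpha) (halpha1 : alpha < 1) (hC : 0 < C) (hr : (0 < r)%N)
    (d d' : measure_display)
    (Omega : measurableType d) (P : probability Omega R)
    (S : R -> Omega -> R)
    (hS : driftless_subordinator P S (stable_density alpha C))
    (Omega' : measurableType d') (P' : probability Omega' R)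
    (N : Omega' -> {measure set R -> \bar R})
    (hN : negative_binomial_process P' r%:R (truncated_stable_density alpha) N)
    (A : set (nat -> R)) (hA : seq_measurable A) :
  PD P S r A = PK P' N A.
Proof.
rewrite /PD /PK /law (law_trimmed_ratios halpha0 hC hr hS hA).
(* Both normalised sequences come from the same measurable map, so the laws before normalisation are
   compared, at the preimage of [A]. *)
transitivity (P' ((fun w i => ranked_point (N w) i) @^-1` (normalize_seq @^-1` A))).
  apply: (counted_ranks_law_eq (counted_ranks_relative_jump halpha0 hC hr hS) (counted_ranks_ranked_point hN)).
    move=> n x z x01 x0 xS z01.
    rewrite (relative_count_generating_function halpha0 hC hr hS)// ?x01//.
    by rewrite (window_generating_function halpha0 hN)// x01.
  exact: seq_measurable_normalize.
by congr (P' _); apply/seteqP; split => w; rewrite /preimage /= (normalized_points_normalize N w).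
Qed.
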